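(* Let $M$ be a smooth $n$-dimensional manifold with a $C^2$ Lorentzian metric $g$. Let either $F=\mathrm{Ric}_g$, or $F=\mathrm{Ric}_g^{N,V}$ for some real $N\ge n$ and some weight $V\in C^2(M)$ (assumed constant if $N=n$). Then $$F(\mathbf{v},\mathbf{v})\ge 0\quad\text{for all } \mathbf{v}\in TM \text{ with } g(\mathbf{v},\mathbf{v})=0$$ if and only if for every compact $Z\subseteq M$ there exists a constant $C_Z^T\in\mathbb{R}$ such that $$F(\mathbf{v},\mathbf{v})\ge C_Z^T\, g(\mathbf{v},\mathbf{v})\quad\text{for all } \mathbf{v}\in TM|_Z \text{ with } g(\mathbf{v},\mathbf{v})<0 .$$
   Context: Lorentzian metrics have signature $(-,+,\dots,+)$. $\mathrm{Ric}_g$ is the Ricci tensor of $g$. For $N>n$ and $V\in C^2(M)$ the $N$-Bakry–Émery–Ricci tensor is $$\mathrm{Ric}_g^{N,V}:=\mathrm{Ric}_g+\mathrm{Hess}_g(V)-\frac{1}{N-n}\,DV\otimes DV ,$$ where $\mathrm{Hess}_g(V)$ is the Hessian with respect to the Levi-Civita connection and $DV$ is the differential; for $N=n$ the weight $V$ is required to be constant and $\mathrm{Ric}_g^{n,V}:=\mathrm{Ric}_g$. $TM|_Z$ denotes the set of all tangent vectors of $M$ with base point in $Z$. *)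

(* Defs.v *)
From HB Require Import structures.
From mathcomp Require Import all_boot all_order all_algebra.
From mathcomp Require Import all_classical all_reals all_analysis.

Set Implicit Arguments.
Unset Strict Implicit.
Unset Printing Implicit Defensive.

Import Order.TTheory GRing.Theory Num.Theory.
Import numFieldNormedType.Exports.

Local Open Scope classical_set_scope.
Local Open Scope ring_scope.

(* Vectors of R^n are row vectors, so Jacobians act on the right:             *)
(* 'd f x u = u *m 'J f x.                                                    *)

(* Class C^k on an open set U: differentiability (in the Frechet sense) with  *)
(* directional derivatives of class C^(k-1).                                  *)
Fixpoint Ck_on (R : realType) (n : nat) (W : normedModType R) (k : nat)
    (U : set 'rV[R]_n) (f : 'rV[R]_n -> W) : Prop :=
  if k is k'.+1 then
    (forall x, U x -> differentiable f x) /\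
    (forall u, Ck_on k' U (fun x => 'D_u f x))
  else forall x, U x -> {for x, continuous f}.

Record chart (R : realType) (n : nat) (M : topologicalType) := Chart {
  chart_dom : set M;
  chart_map :> M -> 'rV[R]_n;
  chart_inv : 'rV[R]_n -> M;
  chart_dom_open : open chart_dom;
  chart_img_open : open (chart_map @` chart_dom);
  chart_mapK : forall p, chart_dom p -> chart_inv (chart_map p) = p;
  chart_map_continuous :
    forall p, chart_dom p -> {for p, continuous chart_map};
  chart_inv_continuous :
    forall x, (chart_map @` chart_dom) x -> {for x, continuous chart_inv}
}.

Definition chart_img (R : realType) (n : nat) (M : topologicalType)
  (a : chart R n M) : set 'rV[R]_n := a @` chart_dom a.

Definition transition (R : realType) (n : nat) (M : topologicalType)
  (a b : chart R n M) : 'rV[R]_n -> 'rV[R]_n := b \o chart_inv a.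

(* The atlas need not be maximal. *)
Record manifold (R : realType) (n : nat) := Manifold {
  manifold_sort :> topologicalType;
  manifold_hausdorff : hausdorff_space manifold_sort;
  manifold_second_countable : @second_countable manifold_sort;
  atlas : set (chart R n manifold_sort);
  atlas_cover : forall p, exists a, atlas a /\ chart_dom a p;
  atlas_smooth : forall a b, atlas a -> atlas b -> forall k,
    Ck_on k (a @` (chart_dom a `&` chart_dom b)) (transition a b)
}.

Section Manifold.
Variables (R : realType) (n : nat) (M : manifold R n).
Local Notation chart := (chart R n M).

Definition chart_around (p : M) (a : chart) := atlas a /\ chart_dom a p.

Definition chart_at (p : M) : chart := projT1 (cid (atlas_cover p)).

Lemma chart_atP (p : M) : chart_around p (chart_at p).
Proof. exact: (projT2 (cid (atlas_cover p))). Qed.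

(* A tangent vector at p is the family of its components in all the charts    *)
(* around p, related by the differentials of the transition maps.  The        *)
(* components in the remaining charts carry no information; fixing them to 0  *)
(* makes a vector determined by its components in any one chart around p.     *)
Record tangent (p : M) := Tangent {
  tcomp :> chart -> 'rV[R]_n;
  tcomp_transition : forall a b, chart_around p a -> chart_around p b ->
    tcomp b = 'd (transition a b) (a p) (tcomp a);
  tcomp_out : forall a, ~ chart_around p a -> tcomp a = 0
}.

(* The components T_ij of a covariant 2-tensor field: a matrix-valued         *)
(* function in each chart, relevant on chart_img only.                        *)
Definition components := chart -> 'rV[R]_n -> 'M[R]_n.

(* T(v, w) = T_ij v^i w^j.  When T obeys the tensor transformation law, any   *)
(* chart around p gives the same value as chart_at p.                         *)
Definition tensor_eval (T : components) (p : M) (v w : tangent p) : R :=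
  let a := chart_at p in \sum_i \sum_j T a (a p) i j * v a 0 i * w a 0 j.

(* A symmetric bilinear form has signature (-,+,...,+) when its matrix is     *)
(* diag(-1,1,...,1) in some basis; i0 is the position of the entry -1.        *)
Definition lorentzian (G : 'M[R]_n) : Prop :=
  G^T = G /\ exists (i0 : 'I_n) (P : 'M[R]_n), P \in unitmx /\
    P *m G *m P^T = diag_mx (\row_j (if j == i0 then -1 else 1)).

Record lorentz_metric := LorentzMetric {
  metric_comp : components;
  metric_C2 : forall a, atlas a -> forall i j,
    Ck_on 2 (chart_img a) (fun x => metric_comp a x i j : R^o);
  metric_lorentzian : forall a, atlas a -> forall x, chart_img a x ->
    lorentzian (metric_comp a x);
  metric_transition : forall p a b, chart_around p a -> chart_around p b ->
    metric_comp a (a p) =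
      'J (transition a b) (a p) *m metric_comp b (b p)
        *m ('J (transition a b) (a p))^T
}.

Definition metric (g : lorentz_metric) (p : M) (v w : tangent p) : R :=
  tensor_eval (metric_comp g) v w.

Definition partial (i : 'I_n) (f : 'rV[R]_n -> R) (x : 'rV[R]_n) : R :=
  'D_(delta_mx 0 i) (f : 'rV[R]_n -> R^o) x.

(* christoffel g a k i j is Gamma^k_ij. *)
Definition christoffel (g : lorentz_metric) (a : chart) (k i j : 'I_n)
    (x : 'rV[R]_n) : R :=
  let G := metric_comp g a in
  2^-1 * \sum_l invmx (G x) k l *
    (partial i (fun y => G y j l) x + partial j (fun y => G y i l) x
     - partial l (fun y => G y i j) x).

(* riemann g a l k i j is R^l_kij, with R(d_i, d_j) d_k = R^l_kij d_l and     *)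
(* R(X, Y) = [D_X, D_Y] - D_[X,Y].                                            *)
Definition riemann (g : lorentz_metric) (a : chart) (l k i j : 'I_n)
    (x : 'rV[R]_n) : R :=
  let Gamma := christoffel g a in
  partial i (Gamma l j k) x - partial j (Gamma l i k) x
  + \sum_m (Gamma l i m x * Gamma m j k x - Gamma l j m x * Gamma m i k x).

Definition ricci_comp (g : lorentz_metric) : components := fun a x =>
  \matrix_(j, k) \sum_i riemann g a i k i j x.

Definition ricci (g : lorentz_metric) (p : M) (v w : tangent p) : R :=
  tensor_eval (ricci_comp g) v w.

Definition weight_C2 (V : M -> R) : Prop := forall a : chart, atlas a ->
  Ck_on 2 (chart_img a) (V \o chart_inv a : 'rV[R]_n -> R^o).

Definition hess_comp (g : lorentz_metric) (V : M -> R) : components :=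
  fun a x => let f := V \o chart_inv a in
  \matrix_(i, j) (partial i (partial j f) x
                  - \sum_k christoffel g a k i j x * partial k f x).

Definition hess (g : lorentz_metric) (V : M -> R) (p : M) (v w : tangent p) : R :=
  tensor_eval (hess_comp g V) v w.

(* DV applied to a tangent vector at p, computed in chart_at p. *)
Definition dweight (V : M -> R) (p : M) (v : tangent p) : R :=
  let a := chart_at p in
  \sum_i partial i (V \o chart_inv a) (a p) * v a 0 i.

(* For N = n this is Ric_g, V being then required to be constant. *)
Definition bakry_emery_ricci (g : lorentz_metric) (N : R) (V : M -> R)
    (p : M) (v w : tangent p) : R :=
  if N == n%:R then ricci g v w
  else ricci g v w + hess g V v w
       - (N - n%:R)^-1 * (dweight V v * dweight V w).

End Manifold.

(* Main.v *)
Require Import Defs.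
From mathcomp Require Import all_boot all_order all_algebra.
From mathcomp Require Import all_classical all_reals all_analysis.
From mathcomp Require Import ring lra.

(** The interesting direction is local. Near a given point fix a constant
    vector e which is timelike there. For v timelike, let s be the smaller root
    of g(v - s e, v - s e) = 0, so that w = v - s e is null and
    F(v, v) = F(w, w) + s (F(v, e) + F(e, v)) - s^2 F(e, e). The product of the
    two roots is a multiple of g(v, v), and the larger one dominates |v|, hence
    s |v| and s^2 are bounded by multiples of |g(v, v)|; F being locally
    bounded, F(v, v) >= C g(v, v) with C locally uniform. Conversely, a null v
    is the limit of the timelike vectors v + t e.

    A tensor is evaluated at p in an arbitrarily chosen chart, so local
    boundedness in one chart is of use only once the Ricci tensor and the
    Hessian are known to be tensors. Let Gamma_i be the matrix of D_(d_i) in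
    the coordinate frame. By uniqueness of the Levi-Civita connection, a change
    of coordinates with Jacobian J acts on these matrices by the gauge
    transformation Gamma_i J = d_i J + J B_i, where B is the pullback of the
    connection matrices of the other chart; differentiating this relation and
    antisymmetrizing shows that the curvature matrices are conjugated by J. *)

Set Implicit Arguments.
Unset Strict Implicit.
Unset Printing Implicit Defensive.

Import Order.TTheory GRing.Theory Num.Theory.
Import numFieldNormedType.Exports.

Local Open Scope classical_set_scope.
Local Open Scope ring_scope.

(** * Functions of class C^k *)

(** Differentiability is local: the first-order expansion of [f] at [x] is also one of [g], and by
    uniqueness its linear part is the differential of [g]. *)
Lemma near_eq_differentiable (R : numFieldType) (V W : normedModType R)
    (f g : V -> W) (x : V) :
  {near x, f =1 g} -> differentiable f x -> differentiable g x.
Proof.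
move=> fg /diff_locallyP[dfc dfx].
have sx : shift x h @[h --> 0] --> x.
  rewrite -[X in _ --> X]add0r; apply: cvgD; [exact: cvg_id|exact: cvg_cst].
have nh : \forall h \near 0, g (h + x) = f (h + x).
  by apply: (sx [set y | g y = f y]); apply: filterS fg => y /esym.
have gx : g \o shift x = cst (g x) + 'd f x +o_ 0 id.
  apply/eqaddoP => e e0; move/eqaddoP : dfx => /(_ e e0) dfx.
  near=> h.
  have -> : (g \o shift x - (cst (g x) + 'd f x)) h =
            (f \o shift x - (cst (f x) + 'd f x)) h.
    rewrite !fctE /= (nbhs_singleton fg); congr (_ - _).
    by near: h.
  by near: h.
apply/diff_locallyP; rewrite (diff_unique dfc gx); split => //.
Unshelve. all: by end_near. Qed.

Section Ck.
Context {R : realType} {n : nat}.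
Implicit Types (U : set 'rV[R]_n) (k : nat).

Lemma Ck_onW (W : normedModType R) k U (f : 'rV[R]_n -> W) :
  Ck_on k.+1 U f -> Ck_on k U f.
Proof.
elim: k f => [|k IH] f [df Df] /=.
  by move=> x Ux; apply: differentiable_continuous; exact: df.
by split => // u; apply: IH.
Qed.

Lemma Ck_on_continuous (W : normedModType R) k U (f : 'rV[R]_n -> W) x :
  Ck_on k U f -> U x -> {for x, continuous f}.
Proof. by elim: k => [|k IH]; [apply | move/Ck_onW; exact: IH]. Qed.

Lemma Ck_on_sub (W : normedModType R) k U V (f : 'rV[R]_n -> W) :
  V `<=` U -> Ck_on k U f -> Ck_on k V f.
Proof.
move=> VU; elim: k f => [|k IH] f /=; first by move=> + x /VU; apply.
by move=> [df Df]; split => [x /VU /df//|u]; apply: IH.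
Qed.

(** As [U] is open, agreement on [U] is agreement near each of its points, so the directional
    derivatives also agree on [U] and induction on [k] applies. *)
Lemma eq_Ck_on (W : normedModType R) k U (f g : 'rV[R]_n -> W) :
  open U -> (forall x, U x -> f x = g x) -> Ck_on k U f -> Ck_on k U g.
Proof.
move=> oU fg.
have near_fg (h1 h2 : 'rV[R]_n -> W) x :
    (forall x, U x -> h1 x = h2 x) -> U x -> {near x, h1 =1 h2}.
  by move=> h12 Ux; apply: filterS (open_nbhs_nbhs (conj oU Ux)) => y /h12.
elim: k f g fg => [|k IH] f g fg.
  move=> cf x Ux; suff : g y @[y --> x] --> g x by [].
  rewrite -(fg _ Ux); apply: cvg_trans (cf x Ux).
  exact: near_eq_cvg (near_fg _ _ _ fg Ux).
move=> [df Df]; split => [x Ux|u].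
  exact: near_eq_differentiable (near_fg _ _ _ fg Ux) (df x Ux).
by apply: IH (Df u) => x Ux; exact: near_eq_derive (near_fg _ _ _ fg Ux).
Qed.

Lemma Ck_on_cst (W : normedModType R) k U (c : W) : Ck_on k U (cst c).
Proof.
elim: k c => [|k IH] c /=; first by move=> x _; exact: cst_continuous.
split => [x _|u]; first exact: differentiable_cst.
by under eq_fun do rewrite derive_cst; exact: IH.
Qed.

Lemma Ck_onD (W : normedModType R) k U (f g : 'rV[R]_n -> W) : open U ->
  Ck_on k U f -> Ck_on k U g -> Ck_on k U (fun x => f x + g x).
Proof.
move=> oU; elim: k f g => [|k IH] f g /=.
  by move=> cf cg x Ux; apply: continuousD; [exact: cf|exact: cg].
move=> [df Df] [dg Dg]; split => [x Ux|u].
  by apply: differentiableD; [exact: df|exact: dg].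
apply: eq_Ck_on (IH _ _ (Df u) (Dg u)) => // x Ux.
by rewrite -deriveD//; apply: diff_derivable; [exact: df|exact: dg].
Qed.

Implicit Types f g : 'rV[R]_n -> R^o.

Lemma Ck_onM k U f g : open U ->
  Ck_on k U f -> Ck_on k U g -> Ck_on k U (fun x => f x * g x : R^o).
Proof.
move=> oU; elim: k f g => [|k IH] f g.
  by move=> cf cg x Ux; apply: continuousM; [exact: cf|exact: cg].
move=> cf cg; case: (cf) => [df Df]; case: (cg) => [dg Dg]; split => [x Ux|u].
  by apply: differentiableM; [exact: df|exact: dg].
have h := Ck_onD oU (IH _ _ (Ck_onW cf) (Dg u)) (IH _ _ (Ck_onW cg) (Df u)).
apply: eq_Ck_on h => // x Ux.
by rewrite -[RHS]/('D_u (f * g) x) deriveM//; apply: diff_derivable;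
  [exact: df|exact: dg].
Qed.

Lemma Ck_onN k U f : open U -> Ck_on k U f -> Ck_on k U (fun x => - f x : R^o).
Proof.
move=> oU cf; have h := Ck_onM oU (Ck_on_cst k U (-1 : R^o)) cf.
by apply: eq_Ck_on h => // x _; rewrite /cst mulN1r.
Qed.

Lemma Ck_onB k U f g : open U ->
  Ck_on k U f -> Ck_on k U g -> Ck_on k U (fun x => f x - g x : R^o).
Proof. by move=> oU cf cg; apply: Ck_onD => //; exact: Ck_onN. Qed.

Lemma Ck_on_sum k U (I : Type) (r : seq I) (P : pred I)
    (F : I -> 'rV[R]_n -> R^o) : open U ->
  (forall i, Ck_on k U (F i)) ->
  Ck_on k U (fun x => \sum_(i <- r | P i) F i x : R^o).
Proof.
move=> oU cF; elim: r => [|i r IH].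
  by under eq_fun do rewrite big_nil; exact: Ck_on_cst.
under eq_fun do rewrite big_cons.
by case: (P i) => //; exact: Ck_onD.
Qed.

Lemma Ck_on_prod k U (I : Type) (r : seq I) (P : pred I)
    (F : I -> 'rV[R]_n -> R^o) : open U ->
  (forall i, Ck_on k U (F i)) ->
  Ck_on k U (fun x => \prod_(i <- r | P i) F i x : R^o).
Proof.
move=> oU cF; elim: r => [|i r IH].
  by under eq_fun do rewrite big_nil; exact: Ck_on_cst.
under eq_fun do rewrite big_cons.
by case: (P i) => //; exact: Ck_onM.
Qed.

(** Induction from D(1/f) = -(1/f)^2 Df, whose right-hand side needs 1/f only one order lower. *)
Lemma Ck_onV k U f : open U -> (forall x, U x -> f x != 0) ->
  Ck_on k U f -> Ck_on k U (fun x => (f x)^-1 : R^o).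
Proof.
move=> oU f0; elim: k => [|k IH].
  move=> cf x Ux; apply: (@continuous_comp _ _ _ f GRing.inv).
    exact: cf.
  exact: differentiable_continuous (differentiable_Rinv (f0 _ Ux)).
move=> cf; case: (cf) => [df Df]; split => [x Ux|u].
  by apply: differentiableV; [exact: df|exact: f0].
have fV := IH (Ck_onW cf).
have h := Ck_onN oU (Ck_onM oU (Ck_onM oU fV fV) (Df u)).
apply: eq_Ck_on h => // x Ux.
rewrite deriveV//; [|exact: f0|by apply: diff_derivable; exact: df].
by rewrite scaleNr -exprVn expr2.
Qed.

Lemma Ck_on_coord k U (p q : nat) (A : 'rV[R]_n -> 'M[R]_(p, q)) i j :
  open U -> Ck_on k U A -> Ck_on k U (fun x => A x i j : R^o).
Proof.
move=> oU; elim: k A => [|k IH] A.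
  move=> cA x Ux; apply: (@continuous_comp _ _ _ A (fun M => M i j)).
    exact: cA.
  exact: coord_continuous.
move=> [dA DA]; split => [x Ux|u].
  apply: (@differentiable_comp _ _ _ _ A (fun M : 'M[R]_(p, q) => M i j : R^o)).
    exact: dA.
  exact: differentiable_coord.
apply: eq_Ck_on (IH _ (DA u)) => // x Ux.
by rewrite derive_mx ?mxE//; apply: diff_derivable; exact: dA.
Qed.

Lemma Ck_on_det k U (m : nat) (A : 'rV[R]_n -> 'M[R]_m) : open U ->
  (forall i j, Ck_on k U (fun x => A x i j : R^o)) ->
  Ck_on k U (fun x => \det (A x) : R^o).
Proof.
move=> oU cA; apply: Ck_on_sum => // s; apply: Ck_onM => //.
  exact: Ck_on_cst.
by apply: Ck_on_prod.
Qed.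

(** Cramer's rule: the entries are cofactors divided by the nonvanishing determinant. *)
Lemma Ck_on_invmx k U (m : nat) (A : 'rV[R]_n -> 'M[R]_m) i j : open U ->
  (forall x, U x -> A x \in unitmx) ->
  (forall i j, Ck_on k U (fun x => A x i j : R^o)) ->
  Ck_on k U (fun x => invmx (A x) i j : R^o).
Proof.
move=> oU uA cA.
have h : Ck_on k U (fun x => (\det (A x))^-1 * cofactor (A x) j i : R^o).
  apply: Ck_onM => //.
    apply: Ck_onV => //; last exact: Ck_on_det.
    by move=> x /uA; rewrite unitmxE unitfE.
  apply: Ck_onM => //; first exact: Ck_on_cst.
  apply: Ck_on_det => // a b.
  by under eq_fun do rewrite !mxE; exact: cA.
by apply: eq_Ck_on h => // x /uA uAx; rewrite /invmx uAx !mxE.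
Qed.

End Ck.

(** * Symmetry of second derivatives *)

Section Schwarz.
Context {R : realType} {V : normedModType R}.
Implicit Types f : V -> R^o.

Lemma is_derive_line f (t : R) (u y : V) : differentiable f (t *: u + y) ->
  is_derive t 1 (fun s : R => f (s *: u + y) : R^o) ('D_u f (t *: u + y)).
Proof.
move=> fd; have df : derivable f (t *: u + y) u by exact: diff_derivable.
pose l (s : R) : R^o := f (s *: u + y).
have E : (fun h : R => h^-1 *: ((l \o shift t) (h *: (1 : R^o)) - l t)) =
    (fun h => h^-1 *: ((f \o shift (t *: u + y)) (h *: u) - f (t *: u + y))).
  by apply/funext => h; rewrite /l /= [h *: (1 : R^o)]mulr1 scalerDl addrA.
change (is_derive t 1 l ('D_u f (t *: u + y))).
by split; [rewrite /derivable E | rewrite /derive E].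
Qed.

Lemma derive_addr f (a u x : V) :
  'D_u (fun y => f (y + a)) x = 'D_u f (x + a).
Proof.
have E : (fun t => t^-1 *: (((fun y => f (y + a)) \o shift x) (t *: u)
      - f (x + a))) =
    (fun t => t^-1 *: ((f \o shift (x + a)) (t *: u) - f (x + a))).
  by apply/funext => t /=; rewrite addrA.
by rewrite /derive E.
Qed.

Lemma MVT_line f (h : R) (u y : V) : 0 <= h ->
  (forall s, 0 <= s <= h -> differentiable f (s *: u + y)) ->
  exists2 c, 0 <= c <= h & f (h *: u + y) - f y = 'D_u f (c *: u + y) * h.
Proof.
move=> h0 df.
have dl s : s \in `[0, h] -> is_derive s 1 (fun s : R => f (s *: u + y) : R^o)
    ('D_u f (s *: u + y)).
  by rewrite in_itv /= => /df; exact: is_derive_line.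
have cl : {within `[0, h], continuous (fun s : R => f (s *: u + y) : R^o)}.
  by apply: derivable_within_continuous => s /dl [].
have dlo s : s \in `]0, h[ -> is_derive s 1 (fun s : R => f (s *: u + y) : R^o)
    ('D_u f (s *: u + y)).
  by move=> sh; apply: dl; apply: subset_itv_oo_cc sh.
have [c] := @MVT_segment R (fun s : R => f (s *: u + y) : R^o)
    (fun s : R => 'D_u f (s *: u + y) : R^o) 0 h h0 dlo cl.
rewrite in_itv /= scale0r add0r subr0 => c0h E.
by exists c.
Qed.

(** The mean value theorem is applied along [u] to the increment of [f] by [h *: v], then along [v]
    to ['D_u f]. The left-hand side is the second difference of [f], which is symmetric in [u] and
    [v]. *)
Lemma MVT_parallelogram f (h : R) (u v x : V) : 0 <= h ->
  (forall s t, 0 <= s <= h -> 0 <= t <= h ->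
     differentiable f (s *: u + (t *: v + x))
     /\ differentiable ('D_u f) (t *: v + (s *: u + x))) ->
  exists c d, [/\ 0 <= c <= h, 0 <= d <= h &
    f (h *: u + (h *: v + x)) - f (h *: v + x) - (f (h *: u + x) - f x) =
      'D_v ('D_u f) (d *: v + (c *: u + x)) * h * h].
Proof.
move=> h0 df.
have hh : 0 <= h <= h by rewrite h0 lexx.
have h00 : 0 <= (0 : R) <= h by rewrite h0 lexx.
pose k (y : V) : R^o := f (y + h *: v) - f y.
have dk s : 0 <= s <= h -> differentiable (fun y => f (y + h *: v)) (s *: u + x).
  move=> sh; apply: (@differentiable_comp _ _ _ _ (shift (h *: v)) f).
    by apply: differentiableD; [exact: ex_diff|exact: differentiable_cst].
  rewrite /= -addrA [x + _]addrC.
  by have [] := df s h sh hh.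
have df0 s : 0 <= s <= h -> differentiable f (s *: u + x).
  by move=> sh; have [+ _] := df s 0 sh h00; rewrite scale0r add0r.
have [c ch Ec] : exists2 c, 0 <= c <= h &
    k (h *: u + x) - k x = 'D_u k (c *: u + x) * h.
  apply: MVT_line => // s sh; apply: differentiableB; first exact: dk.
  exact: df0.
have Dk : 'D_u k (c *: u + x) =
    'D_u f (h *: v + (c *: u + x)) - 'D_u f (c *: u + x).
  rewrite deriveB; first congr (_ - _).
  - by rewrite derive_addr [in LHS]addrC.
  - exact/diff_derivable/dk.
  - exact/diff_derivable/df0.
have [d dh Ed] : exists2 d, 0 <= d <= h &
    'D_u f (h *: v + (c *: u + x)) - 'D_u f (c *: u + x) =
    'D_v ('D_u f) (d *: v + (c *: u + x)) * h.
  by apply: (@MVT_line ('D_u f)) => // s sh; have [] := df c s ch sh.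
exists c, d; split => //; rewrite -Ed -Dk -Ec /k.
rewrite -[h *: u + x + h *: v]addrA [x + h *: v]addrC.
have E4 (a b c0 d0 : R) : a - b - (c0 - d0) = a - c0 - (b - d0) by ring.
exact: E4.
Qed.

(** By symmetry of the second difference, each mixed derivative takes a common value at some point
    of any small parallelogram at [x]. Continuity of both at [x] then forces them to agree there. *)
Lemma derive_comm f (u v x : V) :
  (\forall y \near x, [/\ differentiable f y, differentiable ('D_u f) y &
     differentiable ('D_v f) y]) ->
  {for x, continuous ('D_v ('D_u f) : V -> R^o)} ->
  {for x, continuous ('D_u ('D_v f) : V -> R^o)} ->
  'D_v ('D_u f) x = 'D_u ('D_v f) x.
Proof.
move=> df cvu cuv; apply/eqP/contraT => neqAB.
set A := 'D_v ('D_u f) x in neqAB; set B := 'D_u ('D_v f) x in neqAB.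
pose e := `|A - B| / 2.
have e0 : 0 < e by rewrite divr_gt0 ?normr_gt0 ?subr_eq0.
have nA : \forall y \near x, `|A - 'D_v ('D_u f) y| < e.
  by move/cvgrPdist_lt : cvu; apply.
have nB : \forall y \near x, `|B - 'D_u ('D_v f) y| < e.
  by move/cvgrPdist_lt : cuv; apply.
have near_x : \forall y \near x, [/\ differentiable f y,
    differentiable ('D_u f) y & differentiable ('D_v f) y] /\
    `|A - 'D_v ('D_u f) y| < e /\ `|B - 'D_u ('D_v f) y| < e.
  exact: filterI df (filterI nA nB).
move/nbhs_ballP : near_x => [r /= r0 xr].
(* This side length keeps the parallelogram inside the ball of radius [r]; the summand 1 avoids a
   division by zero when [u] and [v] vanish. *)
pose h := r / (2 * (1 + `|u| + `|v|)).
have N0 : 0 < 1 + `|u| + `|v| by rewrite -addrA ltr_pwDl// addr_ge0.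
have h0 : 0 < h by rewrite divr_gt0// mulr_gt0.
have near_h s t : 0 <= s <= h -> 0 <= t <= h ->
    ball x r (s *: u + (t *: v + x)).
  move=> /andP[s0 sh] /andP[t0 th].
  rewrite -ball_normE /= addrA opprD addrCA subrr addr0 normrN.
  rewrite (le_lt_trans (ler_normD _ _))// !normrZ !ger0_norm//.
  apply: (@le_lt_trans _ _ (h * (1 + `|u| + `|v|))).
    rewrite -addrA 2!mulrDr mulr1 -lerBlDr.
    rewrite (@le_trans _ _ 0)//; last exact: ltW.
    by rewrite subr_le0 lerD// ler_wpM2r.
  by rewrite /h invfM mulrA divfK ?gt_eqF// ltr_pdivrMr// ltr_pMr// ltr1n.
have swp s t : s *: v + (t *: u + x) = t *: u + (s *: v + x) by rewrite addrCA.
have [c [d [ch dh E1]]] : exists c d, [/\ 0 <= c <= h, 0 <= d <= h &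
    f (h *: u + (h *: v + x)) - f (h *: v + x) - (f (h *: u + x) - f x) =
      'D_v ('D_u f) (d *: v + (c *: u + x)) * h * h].
  apply: MVT_parallelogram => [|s t sh th]; first exact: ltW.
  by rewrite swp; have [[]] := xr _ (near_h _ _ sh th).
have [c' [d' [ch' dh' E2]]] : exists c d, [/\ 0 <= c <= h, 0 <= d <= h &
    f (h *: v + (h *: u + x)) - f (h *: u + x) - (f (h *: v + x) - f x) =
      'D_u ('D_v f) (d *: u + (c *: v + x)) * h * h].
  apply: MVT_parallelogram => [|s t sh th]; first exact: ltW.
  by rewrite swp; have [[]] := xr _ (near_h _ _ th sh).
(* The common value lies at distance less than half of |A - B| from both [A] and [B], which is
   absurd. *)
have : 'D_v ('D_u f) (d *: v + (c *: u + x)) =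
       'D_u ('D_v f) (d' *: u + (c' *: v + x)).
  apply: (mulIf (lt0r_neq0 h0)); apply: (mulIf (lt0r_neq0 h0)).
  apply: etrans (esym E1) (etrans _ E2).
  have -> : h *: v + (h *: u + x) = h *: u + (h *: v + x) by rewrite addrCA.
  have E3 (a b k l : R) : a - b - (k - l) = a - k - (b - l) by ring.
  exact: E3.
have [_ [hA _]] := xr _ (near_h _ _ ch dh).
have [_ [_ hB]] := xr _ (near_h _ _ dh' ch').
move: hA; rewrite [c *: u + _]addrCA => + E; rewrite {}E => hA.
set z : R := 'D_u ('D_v f) _ in hA hB.
have lez (a b : R) : `|a - b| <= `|a - z| + `|b - z|.
  by rewrite [`|b - z|]distrC ler_distD.
have := le_lt_trans (lez A B) (ltrD hA hB).
by rewrite /e -splitr ltxx.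
Qed.
End Schwarz.

(** * Partial derivatives of matrices *)

Section MatrixCalculus.
Context {R : realType} {n : nat}.
Implicit Types (x y : 'rV[R]_n) (f g : 'rV[R]_n -> R^o) (i : 'I_n).

Definition mpartial (p q : nat) i (A : 'rV[R]_n -> 'M[R]_(p, q)) x : 'M[R]_(p, q) :=
  \matrix_(j, k) partial i (fun y => A y j k) x.

Definition mdiff (p q : nat) (A : 'rV[R]_n -> 'M[R]_(p, q)) x :=
  forall j k, differentiable (fun y => A y j k : R^o) x.

Lemma partialD i f g x : differentiable f x -> differentiable g x ->
  partial i (fun y => f y + g y) x = partial i f x + partial i g x.
Proof. by move=> df dg; apply: deriveD; exact: diff_derivable. Qed.

Lemma partialM i f g x : differentiable f x -> differentiable g x ->
  partial i (fun y => f y * g y) x = partial i f x * g x + f x * partial i g x.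
Proof.
move=> df dg; rewrite addrC [partial i f x * _]mulrC.
by apply: deriveM; exact: diff_derivable.
Qed.

Lemma differentiable_fsum (I : finType) (P : pred I) (F : I -> 'rV[R]_n -> R^o) x :
  (forall k, differentiable (F k) x) ->
  differentiable (fun y => \sum_(k | P k) F k y : R^o) x.
Proof.
move=> dF; elim: (index_enum I) => [|k r IH].
  by under eq_fun do rewrite big_nil; exact: differentiable_cst.
by under eq_fun do rewrite big_cons; case: (P k) => //; exact: differentiableD.
Qed.

Lemma partial_sum (I : finType) (P : pred I) i (F : I -> 'rV[R]_n -> R^o) x :
  (forall k, differentiable (F k) x) ->
  partial i (fun y => \sum_(k | P k) F k y) x = \sum_(k | P k) partial i (F k) x.
Proof.
move=> dF.
pose S (r : seq I) (y : 'rV[R]_n) : R^o := \sum_(k <- r | P k) F k y.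
(* Differentiability of the partial sums is carried through the induction, since additivity of the
   derivative requires it. *)
suff H r : differentiable (S r) x /\
    partial i (S r) x = \sum_(k <- r | P k) partial i (F k) x.
  by have [_] := H (index_enum I).
elim: r => [|k r [IH1 IH2]].
  have -> : S [::] = cst 0 by apply/funext => y; rewrite /S big_nil.
  by rewrite big_nil; split; [exact: differentiable_cst|exact: derive_cst].
have -> : S (k :: r) = if P k then fun y => F k y + S r y else S r.
  by apply/funext => y; rewrite /S big_cons; case: (P k).
rewrite big_cons -IH2; case: (P k) => //; split; first exact: differentiableD.
exact: partialD.
Qed.

Lemma eq_partial i f g x : {near x, f =1 g} -> partial i f x = partial i g x.
Proof. by move=> fg; exact: near_eq_derive. Qed.

Section mx.
Variables (p q r : nat).
Implicit Types (A B : 'rV[R]_n -> 'M[R]_(p, q)) (C : 'rV[R]_n -> 'M[R]_(q, r)).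

Lemma eq_mpartial i A B x : {near x, A =1 B} -> mpartial i A x = mpartial i B x.
Proof.
move=> AB; apply/matrixP => j k; rewrite !mxE; apply: eq_partial.
by apply: filterS AB => y ->.
Qed.

Lemma mdiffM A C x : mdiff A x -> mdiff C x -> mdiff (fun y => A y *m C y) x.
Proof.
move=> dA dC j k; under eq_fun do rewrite mxE.
apply: differentiable_fsum => l.
by apply: differentiableM; [exact: dA|exact: dC].
Qed.

Lemma mpartialD i A B x : mdiff A x -> mdiff B x ->
  mpartial i (fun y => A y + B y) x = mpartial i A x + mpartial i B x.
Proof.
move=> dA dB; apply/matrixP => j k; rewrite !mxE.
under [X in partial i X]eq_fun do rewrite mxE.
by apply: partialD; [exact: dA|exact: dB].
Qed.

Lemma mpartialM i A C x : mdiff A x -> mdiff C x ->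
  mpartial i (fun y => A y *m C y) x = mpartial i A x *m C x + A x *m mpartial i C x.
Proof.
move=> dA dC; apply/matrixP => j k; rewrite !mxE.
under [X in partial i X]eq_fun do rewrite mxE.
rewrite partial_sum => [|l]; last first.
  by apply: differentiableM; [exact: dA|exact: dC].
rewrite -big_split /=; apply: eq_bigr => l _; rewrite !mxE.
by apply: partialM; [exact: dA|exact: dC].
Qed.

Lemma mpartial_tr i A x : mpartial i (fun y => (A y)^T) x = (mpartial i A x)^T.
Proof.
apply/matrixP => j k; rewrite !mxE.
by under [X in partial i X]eq_fun do rewrite mxE.
Qed.

Lemma mdiff_tr A x : mdiff A x -> mdiff (fun y => (A y)^T) x.
Proof. by move=> dA j k; under eq_fun do rewrite mxE; exact: dA. Qed.

Lemma mdiffZ f A x : differentiable f x -> mdiff A x ->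
  mdiff (fun y => f y *: A y) x.
Proof.
move=> df dA j k; under eq_fun do rewrite mxE.
by apply: differentiableM => //; exact: dA.
Qed.

Lemma mpartialZ i f A x : differentiable f x -> mdiff A x ->
  mpartial i (fun y => f y *: A y) x
  = partial i f x *: A x + f x *: mpartial i A x.
Proof.
move=> df dA; apply/matrixP => j k; rewrite !mxE.
under [X in partial i X]eq_fun do rewrite mxE.
by rewrite partialM//; exact: dA.
Qed.

Lemma mdiff_sum (I : finType) (F : I -> 'rV[R]_n -> 'M[R]_(p, q)) x :
  (forall k, mdiff (F k) x) -> mdiff (fun y => \sum_k F k y) x.
Proof.
move=> dF j k; under eq_fun do rewrite summxE.
by apply: differentiable_fsum => l; exact: dF.
Qed.

Lemma mpartial_sum (I : finType) i (F : I -> 'rV[R]_n -> 'M[R]_(p, q)) x :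
  (forall k, mdiff (F k) x) ->
  mpartial i (fun y => \sum_k F k y) x = \sum_k mpartial i (F k) x.
Proof.
move=> dF; apply/matrixP => j k; rewrite !mxE summxE.
under [X in partial i X]eq_fun do rewrite summxE.
rewrite partial_sum => [|l]; last exact: dF.
by apply: eq_bigr => l _; rewrite !mxE.
Qed.

End mx.

Section chain.
Variables (phi : 'rV[R]_n -> 'rV[R]_n) (x : 'rV[R]_n).
Hypothesis dphi : differentiable phi x.

Lemma jacobianE i j : 'J phi x i j = partial i (fun y => phi y 0 j) x.
Proof.
have : 'D_(delta_mx 0 i) phi x = delta_mx 0 i *m 'J phi x.
  exact: deriveEjacobian.
rewrite (derive_mx (diff_derivable dphi)).
by rewrite -rowE => /rowP/(_ j); rewrite !mxE.
Qed.

Lemma partial_comp i (h : 'rV[R]_n -> R^o) : differentiable h (phi x) ->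
  partial i (fun y => h (phi y)) x = \sum_p 'J phi x i p * partial p h (phi x).
Proof.
move=> dh; rewrite /partial -[fun y => _]/(h \o phi) deriveE; last first.
  exact: differentiable_comp.
rewrite diff_comp//= -[X in 'd h _ X]deriveE// deriveEjacobian// -rowE.
rewrite [row _ _]row_sum_delta linear_sum /=; apply: eq_bigr => p _.
by rewrite linearZ /= deriveE// mxE.
Qed.

Lemma mpartial_comp p q i (A : 'rV[R]_n -> 'M[R]_(p, q)) : mdiff A (phi x) ->
  mpartial i (fun y => A (phi y)) x = \sum_k 'J phi x i k *: mpartial k A (phi x).
Proof.
move=> dA; apply/matrixP => j l; rewrite !mxE summxE.
rewrite (partial_comp i (dA j l)).
by apply: eq_bigr => k _; rewrite !mxE.
Qed.

Lemma mdiff_comp p q (A : 'rV[R]_n -> 'M[R]_(p, q)) : mdiff A (phi x) ->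
  mdiff (fun y => A (phi y)) x.
Proof. by move=> dA j k; exact: (differentiable_comp dphi (dA j k)). Qed.

End chain.
End MatrixCalculus.

(** * Connection and curvature matrices *)

Section LeviCivita.
Context {R : realType} {n : nat}.
Implicit Types (x y : 'rV[R]_n) (G : 'rV[R]_n -> 'M[R]_n).

(* Row j, column k is Gamma^k_ij: vectors being rows, this is the matrix of   *)
(* the covariant derivative along d_i in the coordinate frame.                *)
Definition connection G (i : 'I_n) x : 'M[R]_n := \matrix_(j, k)
  (2^-1 * \sum_l invmx (G x) k l *
    (partial i (fun y => G y j l) x + partial j (fun y => G y i l) x
     - partial l (fun y => G y i j) x)).

(** When [D l] is the derivative of the metric matrix along d_l, these are the Christoffel symbols
    of the first kind, with the upper index lowered. *)
Definition koszul (D : 'I_n -> 'M[R]_n) (i : 'I_n) : 'M[R]_n :=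
  \matrix_(j, l) (2^-1 * (D i j l + D j i l - D l i j)).

Lemma koszul_metric (D : 'I_n -> 'M[R]_n) i : (forall l, (D l)^T = D l) ->
  D i = koszul D i + (koszul D i)^T.
Proof.
move=> Ds; apply/matrixP => j k; rewrite !mxE.
have -> : D i k j = D i j k by rewrite -[in LHS]Ds mxE.
by field.
Qed.

(** The algebraic core of the uniqueness of the Levi-Civita connection: once D = L + L^T is
    substituted, the symmetry of [L] in its first two indices cancels everything but twice
    [L i j l]. *)
Lemma koszul_unique (D L : 'I_n -> 'M[R]_n) i :
  (forall i j k, L i j k = L j i k) -> (forall i, D i = L i + (L i)^T) ->
  koszul D i = L i.
Proof.
move=> Ls DL; apply/matrixP => j l; rewrite mxE !DL !mxE.
rewrite (Ls i l j) (Ls j l i) (Ls j i l).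
by field.
Qed.

Lemma connectionE G i x :
  connection G i x = koszul (fun l => mpartial l G x) i *m (invmx (G x))^T.
Proof.
apply/matrixP => j k; rewrite 2!mxE mulr_sumr; apply: eq_bigr => l _.
move: (invmx (G x)) => H.
rewrite [koszul _ _ _ _]mxE [H^T _ _]mxE ![mpartial _ _ _ _ _]mxE.
have E (a b c : R) : a * (b * c) = a * c * b by ring.
exact: E.
Qed.

(** Absence of torsion. The symmetry of [G] is needed near [x], since derivatives of transposed
    entries are compared. *)
Lemma connection_sym G i j k x : {near x, forall y, (G y)^T = G y} ->
  connection G i x j k = connection G j x i k.
Proof.
move=> Gs; rewrite !mxE; congr (_ * _); apply: eq_bigr => l _; congr (_ * _).
rewrite [in LHS]addrC [partial j _ x + _]addrC addrC; congr (_ - _).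
apply: eq_partial; apply: filterS Gs => y Gy.
by rewrite -[in LHS]Gy mxE.
Qed.

(** Compatibility of the connection with the metric, in matrix form. *)
Lemma connection_metric G i x : {near x, forall y, (G y)^T = G y} ->
  G x \in unitmx ->
  mpartial i G x = connection G i x *m G x + (connection G i x *m G x)^T.
Proof.
move=> Gs uG; have Gx : (G x)^T = G x := nbhs_singleton Gs.
rewrite connectionE -mulmxA trmx_inv Gx mulVmx// mulmx1.
apply: (koszul_metric (D := fun l => mpartial l G x)) => l.
by rewrite -mpartial_tr; exact: eq_mpartial.
Qed.

(** Multiplying by [G x] lowers the upper index, which reduces the claim to [koszul_unique]; the
    argument is pointwise in [x]. *)
Lemma connection_unique G (Gamma : 'I_n -> 'M[R]_n) x :
  (G x)^T = G x -> G x \in unitmx ->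
  (forall i j k, Gamma i j k = Gamma j i k) ->
  (forall i, mpartial i G x = Gamma i *m G x + (Gamma i *m G x)^T) ->
  forall i, connection G i x = Gamma i.
Proof.
move=> Gx uG Gs dG i; rewrite connectionE trmx_inv Gx.
rewrite (@koszul_unique _ (fun i => Gamma i *m G x)) ?mulmxK// => a b c.
by rewrite !mxE; apply: eq_bigr => k _; rewrite Gs.
Qed.

End LeviCivita.

(** * Curvature under gauge transformations and pullbacks *)

Section Gauge.
Context {R : realType} {n : nat}.
Implicit Types (x y : 'rV[R]_n) (Gamma B : 'I_n -> 'rV[R]_n -> 'M[R]_n)
  (J : 'rV[R]_n -> 'M[R]_n).

(** The products come in the opposite of the usual order because matrices act on row vectors from
    the right; row k, column l is R^l_kij. *)
Definition curvature Gamma (i j : 'I_n) x : 'M[R]_n :=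
  mpartial i (Gamma j) x - mpartial j (Gamma i) x
  + Gamma j x *m Gamma i x - Gamma i x *m Gamma j x.

(** Eliminates [j], which stands for the mixed second derivative shared by the two equations. *)
Lemma addr_cross (W : zmodType) (a b u w j s t : W) :
  a + u = j + s -> b + w = j + t -> a - b = s - u - (t - w).
Proof.
move=> /(canRL (addrK _)) -> /(canRL (addrK _)) ->.
by rewrite -(addrA j s) -(addrA j t) opprD addrACA subrr add0r.
Qed.

(** The gauge relation is differentiated along d_i and d_j. The difference of the two results is
    free of second derivatives of [J], and the gauge relation itself removes the first ones. *)
Lemma curvature_gauge Gamma B J (i j : 'I_n) x :
  (forall k, {near x, forall y,
     Gamma k y *m J y = mpartial k J y + J y *m B k y}) ->
  (forall k, mdiff (Gamma k) x) -> (forall k, mdiff (B k) x) -> mdiff J x ->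
  (forall k, mdiff (mpartial k J) x) ->
  mpartial i (mpartial j J) x = mpartial j (mpartial i J) x ->
  curvature Gamma i j x *m J x = J x *m curvature B i j x.
Proof.
move=> gauge dG dB dJ ddJ JC.
have E k l : mpartial k (Gamma l) x *m J x + Gamma l x *m mpartial k J x =
    mpartial k (mpartial l J) x +
    (mpartial k J x *m B l x + J x *m mpartial k (B l) x).
  apply: etrans (esym (mpartialM k (dG l) dJ)) _.
  apply: etrans (eq_mpartial k (gauge l)) _.
  apply: etrans (mpartialD k (ddJ l) (mdiffM dJ (dB l))) _.
  by congr (_ + _); exact: mpartialM.
have dJE k : mpartial k J x = Gamma k x *m J x - J x *m B k x.
  by rewrite (nbhs_singleton (gauge k)) addrK.
have Eij := E i j; have Eji := E j i; rewrite -JC in Eji.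
have : mpartial i (Gamma j) x *m J x - mpartial j (Gamma i) x *m J x =
  mpartial i J x *m B j x + J x *m mpartial i (B j) x
  - Gamma j x *m mpartial i J x
  - (mpartial j J x *m B i x + J x *m mpartial j (B i) x
     - Gamma i x *m mpartial j J x).
  exact: addr_cross Eij Eji.
rewrite /curvature !mulmxDl !mulNmx => ->.
rewrite !mulmxDr !mulmxN !dJE !mulmxBl !mulmxBr !mulmxA.
move: (Gamma j x *m Gamma i x *m J x) (Gamma i x *m Gamma j x *m J x)
  (Gamma i x *m J x *m B j x) (Gamma j x *m J x *m B i x)
  (J x *m B i x *m B j x) (J x *m B j x *m B i x)
  (J x *m mpartial i (B j) x) (J x *m mpartial j (B i) x) => a b c d e f g h.
apply/matrixP => k l; rewrite !mxE; ring.
Qed.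

(** The pullback by [phi] of the matrix-valued 1-form with components [Gamma p]; the frame is still
    that of the target coordinates. *)
Definition pullback_connection (phi : 'rV[R]_n -> 'rV[R]_n) Gamma (i : 'I_n) y :=
  \sum_p 'J phi y i p *: Gamma p (phi y).

(** Curvature is a matrix-valued 2-form, built by exterior derivative and product, so it commutes
    with pullback. *)
Lemma curvature_pullback (phi : 'rV[R]_n -> 'rV[R]_n) Gamma (i j : 'I_n) x :
  differentiable phi x -> mdiff (jacobian phi) x ->
  (forall p, mdiff (Gamma p) (phi x)) ->
  (forall p, mpartial i (jacobian phi) x j p = mpartial j (jacobian phi) x i p) ->
  curvature (pullback_connection phi Gamma) i j x =
  \sum_p \sum_q ('J phi x i p * 'J phi x j q) *: curvature Gamma p q (phi x).
Proof.
move=> dphi dJ dG JC; pose J := 'J phi x.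
have dB k l : mpartial k (pullback_connection phi Gamma l) x =
    \sum_q mpartial k (jacobian phi) x l q *: Gamma q (phi x) +
    \sum_q \sum_p (J k p * J l q) *: mpartial p (Gamma q) (phi x).
  rewrite mpartial_sum => [|q]; last first.
    by apply: mdiffZ; [exact: dJ|exact: mdiff_comp].
  rewrite -big_split /=; apply: eq_bigr => q _.
  rewrite mpartialZ; [|exact: dJ|exact: mdiff_comp].
  rewrite (mpartial_comp dphi k (dG q)) scaler_sumr; congr (_ *: _ + _).
    by rewrite mxE.
  by apply: eq_bigr => p _; rewrite scalerA mulrC.
have BB k l : pullback_connection phi Gamma k x *m pullback_connection phi Gamma l x =
    \sum_q \sum_p (J k q * J l p) *: (Gamma q (phi x) *m Gamma p (phi x)).
  rewrite mulmx_suml; apply: eq_bigr => q _.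
  rewrite mulmx_sumr; apply: eq_bigr => p _.
  by rewrite -scalemxAl -scalemxAr scalerA.
rewrite /curvature !dB !BB opprD addrACA.
(* The terms containing second derivatives of [phi] cancel by their symmetry. *)
under [X in X - _ + _]eq_bigr do rewrite JC.
rewrite subrr add0r.
rewrite exchange_big /= [X in _ + X - _]exchange_big /=.
rewrite -!sumrB -big_split -sumrB /=; apply: eq_bigr => p _.
rewrite -!sumrB -big_split -sumrB /=; apply: eq_bigr => q _.
by rewrite [J j q * _]mulrC -!(scalerBr, scalerDr).
Qed.

End Gauge.

(** * Change of coordinates *)

Section CkMatrix.
Context {R : realType} {n : nat}.
Implicit Types (U : set 'rV[R]_n) (k : nat).

Definition mCk (p q : nat) k U (A : 'rV[R]_n -> 'M[R]_(p, q)) :=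
  forall i j, Ck_on k U (fun x => A x i j : R^o).

Lemma mCk_mdiff (p q : nat) k U (A : 'rV[R]_n -> 'M[R]_(p, q)) x :
  mCk k.+1 U A -> U x -> mdiff A x.
Proof. by move=> cA Ux i j; have [+ _] := cA i j; apply. Qed.

Lemma mCk_mpartial (p q : nat) k U (A : 'rV[R]_n -> 'M[R]_(p, q)) i :
  mCk k.+1 U A -> mCk k U (mpartial i A).
Proof.
move=> cA j l; have [_ /(_ (delta_mx 0 i))] := cA j l.
by under [X in _ -> Ck_on _ _ X]eq_fun do rewrite mxE.
Qed.

Lemma Ck_on_jacobian k U (phi : 'rV[R]_n -> 'rV[R]_n) : open U ->
  Ck_on k.+1 U phi -> mCk k U (jacobian phi).
Proof.
move=> oU cphi i j.
have [_ /(_ (delta_mx 0 i))] := Ck_on_coord 0 j oU cphi.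
apply: eq_Ck_on => // x Ux; rewrite jacobianE//.
by case: cphi => + _; apply.
Qed.

Lemma partialC U (f : 'rV[R]_n -> R^o) i j x : open U -> Ck_on 2 U f -> U x ->
  partial i (partial j f) x = partial j (partial i f) x.
Proof.
move=> oU cf Ux; apply: derive_comm.
- apply: filterS (open_nbhs_nbhs (conj oU Ux)) => y Uy.
  case: cf => df Df; split; first exact: df.
    by have [+ _] := Df (delta_mx 0 j); apply.
  by have [+ _] := Df (delta_mx 0 i); apply.
- by case: cf => _ /(_ (delta_mx 0 j))[_ /(_ (delta_mx 0 i))]; apply.
- by case: cf => _ /(_ (delta_mx 0 i))[_ /(_ (delta_mx 0 j))]; apply.
Qed.

Lemma mpartialC (p q : nat) U (A : 'rV[R]_n -> 'M[R]_(p, q)) i j x :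
  open U -> mCk 2 U A -> U x ->
  mpartial i (mpartial j A) x = mpartial j (mpartial i A) x.
Proof.
move=> oU cA Ux; apply/matrixP => a b.
have E (k l : 'I_n) : mpartial k (mpartial l A) x a b =
    partial k (partial l (fun y => A y a b)) x.
  by rewrite mxE; congr (partial k _ x); apply/funext => y; rewrite mxE.
exact: etrans (E i j) (etrans (partialC i j oU (cA a b) Ux) (esym (E j i))).
Qed.

Lemma jacobian_partialC U (phi : 'rV[R]_n -> 'rV[R]_n) i j p x : open U ->
  Ck_on 2 U phi -> U x ->
  mpartial i (jacobian phi) x j p = mpartial j (jacobian phi) x i p.
Proof.
move=> oU cphi Ux; have dphi : forall y, U y -> differentiable phi y.
  by case: cphi.
have E (k l : 'I_n) : mpartial k (jacobian phi) x l p =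
    partial k (partial l (fun y => phi y 0 p)) x.
  rewrite mxE; apply: eq_partial; apply: filterS (open_nbhs_nbhs (conj oU Ux)) => y Uy.
  by rewrite jacobianE//; exact: dphi.
have C := partialC i j oU (Ck_on_coord 0 p oU cphi) Ux.
exact: etrans (E i j) (etrans C (esym (E j i))).
Qed.

Lemma Ck_on_connection k U (G : 'rV[R]_n -> 'M[R]_n) i : open U ->
  (forall x, U x -> G x \in unitmx) -> mCk k.+1 U G ->
  mCk k U (connection G i).
Proof.
move=> oU uG cG j l; under eq_fun do rewrite mxE.
have cdG a b c : Ck_on k U (partial a (fun y => G y b c) : _ -> R^o).
  by have [_] := cG b c; apply.
apply: Ck_onM => //; first exact: Ck_on_cst.
apply: Ck_on_sum => // m; apply: Ck_onM => //.
  by apply: Ck_on_invmx => // a b; apply: Ck_onW; exact: cG.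
by apply: Ck_onB => //; apply: Ck_onD.
Qed.

Lemma mCkB (p q : nat) k U (A B : 'rV[R]_n -> 'M[R]_(p, q)) : open U ->
  mCk k U A -> mCk k U B -> mCk k U (fun x => A x - B x).
Proof.
move=> oU cA cB i j.
apply: eq_Ck_on (Ck_onB oU (cA i j) (cB i j)) => // x _.
by rewrite !mxE.
Qed.

Lemma mCkD (p q : nat) k U (A B : 'rV[R]_n -> 'M[R]_(p, q)) : open U ->
  mCk k U A -> mCk k U B -> mCk k U (fun x => A x + B x).
Proof.
move=> oU cA cB i j.
apply: eq_Ck_on (Ck_onD oU (cA i j) (cB i j)) => // x _.
by rewrite mxE.
Qed.

Lemma mCkM (p q r : nat) k U (A : 'rV[R]_n -> 'M[R]_(p, q))
    (B : 'rV[R]_n -> 'M[R]_(q, r)) : open U ->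
  mCk k U A -> mCk k U B -> mCk k U (fun x => A x *m B x).
Proof.
move=> oU cA cB i j.
have h : Ck_on k U (fun x => \sum_l A x i l * B x l j : R^o).
  by apply: Ck_on_sum => // l; apply: Ck_onM.
by apply: eq_Ck_on h => // x _; rewrite mxE.
Qed.

Lemma mCkZ (p q : nat) k U (c : R) (A : 'rV[R]_n -> 'M[R]_(p, q)) : open U ->
  mCk k U A -> mCk k U (fun x => c *: A x).
Proof.
move=> oU cA i j.
apply: eq_Ck_on (Ck_onM oU (Ck_on_cst k U (c : R^o)) (cA i j)) => // x _.
by rewrite mxE.
Qed.

Lemma mCk_tr (p q : nat) k U (A : 'rV[R]_n -> 'M[R]_(p, q)) : open U ->
  mCk k U A -> mCk k U (fun x => (A x)^T).
Proof.
by move=> oU cA i j; apply: eq_Ck_on (cA j i) => // x _; rewrite mxE.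
Qed.

Lemma mCkW (p q : nat) k U (A : 'rV[R]_n -> 'M[R]_(p, q)) :
  mCk k.+1 U A -> mCk k U A.
Proof. by move=> cA i j; apply: Ck_onW. Qed.

Lemma mCk_curvature k U (Gamma : 'I_n -> 'rV[R]_n -> 'M[R]_n) i j : open U ->
  (forall l, mCk k.+1 U (Gamma l)) -> mCk k U (curvature Gamma i j).
Proof.
move=> oU cG.
have cdG l m : mCk k U (mpartial l (Gamma m)) by exact: mCk_mpartial.
have cGG l m : mCk k U (fun x => Gamma l x *m Gamma m x).
  by apply: mCkM => //; exact: mCkW.
exact: (mCkB oU (mCkD oU (mCkB oU (cdG i j) (cdG j i)) (cGG j i)) (cGG i j)).
Qed.

End CkMatrix.

(** * Transformation laws of the Ricci tensor and of the Hessian *)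

Section TensorTransition.
Context {R : realType} {n : nat}.
Implicit Types (x y : 'rV[R]_n).

Definition ricci_mx (Gamma : 'I_n -> 'rV[R]_n -> 'M[R]_n) x : 'M[R]_n :=
  \matrix_(j, k) \sum_i curvature Gamma i j x k i.

(** The components of the differential, as a column; no index is raised by a metric. *)
Definition gradient (f : 'rV[R]_n -> R^o) x : 'cV[R]_n := \col_i partial i f x.

(** Row [i] is the covariant derivative along d_i of the differential of [f]. *)
Definition hessian_mx (Gamma : 'I_n -> 'rV[R]_n -> 'M[R]_n)
    (f : 'rV[R]_n -> R^o) x : 'M[R]_n :=
  \matrix_(i, j) (mpartial i (gradient f) x - Gamma i x *m gradient f x) j 0.

Lemma mCk_ricci_mx k (U : set 'rV[R]_n) Gamma : open U ->
  (forall l, mCk k.+1 U (Gamma l)) -> mCk k U (ricci_mx Gamma).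
Proof.
move=> oU cG i j.
have h : Ck_on k U (fun x => \sum_l curvature Gamma l i x j l : R^o).
  by apply: Ck_on_sum => // l; exact: mCk_curvature.
by apply: eq_Ck_on h => // x _; rewrite [RHS]mxE.
Qed.

Lemma mCk_gradient k (U : set 'rV[R]_n) (f : 'rV[R]_n -> R^o) :
  Ck_on k.+1 U f -> mCk k U (gradient f).
Proof.
move=> [_ /(_ (delta_mx 0 _)) cf] i j.
have E : (fun x => gradient f x i j : R^o) = partial i f.
  by apply/funext => x; rewrite mxE.
by rewrite E; exact: cf.
Qed.

Lemma mCk_hessian_mx k (U : set 'rV[R]_n) Gamma (f : 'rV[R]_n -> R^o) : open U ->
  (forall l, mCk k U (Gamma l)) -> Ck_on k.+2 U f ->
  mCk k U (hessian_mx Gamma f).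
Proof.
move=> oU cG cf i j; have cgf := mCk_gradient cf.
have h := mCkB oU (mCk_mpartial i cgf) (mCkM oU (cG i) (mCkW cgf)).
by apply: eq_Ck_on (h j 0) => // x _; rewrite [RHS]mxE.
Qed.

(** Both sides contract [C p q m] with two rows of [J], and exchanging the rows amounts to
    exchanging [p] and [q]. *)
Lemma pullback_matrix_sym (J : 'M[R]_n) (C : 'I_n -> 'M[R]_n) i j m :
  (forall p q m, C p q m = C q p m) ->
  (J *m \sum_p J i p *: C p) j m = (J *m \sum_p J j p *: C p) i m.
Proof.
move=> Cs.
have E i' j' : (J *m \sum_p J i' p *: C p) j' m =
    \sum_q \sum_p J j' q * (J i' p * C p q m).
  rewrite mxE; apply: eq_bigr => q _; rewrite summxE mulr_sumr.
  by apply: eq_bigr => p _; rewrite mxE.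
rewrite !E exchange_big /=; apply: eq_bigr => p _; apply: eq_bigr => q _.
by rewrite mulrCA Cs.
Qed.

Variables (U V : set 'rV[R]_n) (phi : 'rV[R]_n -> 'rV[R]_n).
Variables (Ga Gb : 'rV[R]_n -> 'M[R]_n).
Hypotheses (oU : open U) (oV : open V) (cphi : Ck_on 3 U phi).
Hypothesis phiV : forall x, U x -> V (phi x).
Hypothesis uJ : forall x, U x -> 'J phi x \in unitmx.
Hypotheses (cGa : mCk 2 U Ga) (cGb : mCk 2 V Gb).
Hypotheses (uGa : forall x, U x -> Ga x \in unitmx)
  (uGb : forall x, V x -> Gb x \in unitmx).
Hypotheses (sGa : forall x, U x -> (Ga x)^T = Ga x)
  (sGb : forall x, V x -> (Gb x)^T = Gb x).
Hypothesis GaE : forall x, U x -> Ga x = 'J phi x *m Gb (phi x) *m ('J phi x)^T.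

Let dphi x : U x -> differentiable phi x. Proof. by case: cphi => + _; apply. Qed.
Let cJ : mCk 2 U (jacobian phi). Proof. exact: Ck_on_jacobian. Qed.
Let dJ x : U x -> mdiff (jacobian phi) x. Proof. exact: mCk_mdiff cJ. Qed.
Let nearU x : U x -> \forall y \near x, U y.
Proof. by move=> Ux; exact: open_nbhs_nbhs. Qed.
Let nearV x : V x -> \forall y \near x, V y.
Proof. by move=> Vx; exact: open_nbhs_nbhs. Qed.
Let JC x i j p : U x ->
  mpartial i (jacobian phi) x j p = mpartial j (jacobian phi) x i p.
Proof. by apply: jacobian_partialC => //; exact: Ck_onW. Qed.

Local Notation pullb := (pullback_connection phi (connection Gb)).

(** The rows of ['J phi] are the source coordinate fields written in the target frame; this is their
    covariant derivative along d_i for the pulled-back connection. *)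
Let frame_derivative i x : 'M[R]_n :=
  mpartial i (jacobian phi) x + 'J phi x *m pullb i x.

Let frame_derivative_sym i j m x : U x ->
  frame_derivative i x j m = frame_derivative j x i m.
Proof.
move=> Ux; rewrite /frame_derivative [LHS]mxE [RHS]mxE; congr (_ + _).
  exact: JC.
apply: pullback_matrix_sym => p q k; apply: connection_sym.
by apply: filterS (nearV (phiV Ux)) => y; exact: sGb.
Qed.

(** Leibniz' rule on [GaE], with the derivative of [Gb] given by metric compatibility in the target
    chart. *)
Let mpartial_Ga i x : U x ->
  mpartial i Ga x = frame_derivative i x *m Gb (phi x) *m ('J phi x)^T
    + (frame_derivative i x *m Gb (phi x) *m ('J phi x)^T)^T.
Proof.
move=> Ux; have Vx := phiV Ux.
have dGb : mdiff Gb (phi x) by exact: mCk_mdiff cGb _.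
have dGbphi : mdiff (fun y => Gb (phi y)) x by apply: mdiff_comp => //; exact: dphi.
have -> : mpartial i Ga x =
    mpartial i (fun y => 'J phi y *m Gb (phi y) *m ('J phi y)^T) x.
  by apply: eq_mpartial; apply: filterS (nearU Ux) => y; exact: GaE.
rewrite (mpartialM i (mdiffM (dJ Ux) dGbphi) (mdiff_tr (dJ Ux))).
rewrite (mpartialM i (dJ Ux) dGbphi) mpartial_tr (mpartial_comp (dphi Ux) i dGb).
have -> : \sum_k 'J phi x i k *: mpartial k Gb (phi x) =
    pullb i x *m Gb (phi x) + (pullb i x *m Gb (phi x))^T.
  rewrite mulmx_suml linear_sum -big_split /=; apply: eq_bigr => p _.
  rewrite connection_metric; first last.
  - exact: uGb.
  - by apply: filterS (nearV Vx) => y; exact: sGb.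
  by rewrite -scalemxAl scalerDr linearZ.
rewrite /frame_derivative !trmx_mul trmxK sGb// [(_ + _)^T]linearD /= trmx_mul.
rewrite !(mulmxDl, mulmxDr) !mulmxA.
by rewrite -!addrA; congr (_ + (_ + _)); rewrite addrC.
Qed.

(** Brought back to the source frame by [invmx ('J phi x)], the frame derivative is torsion-free and
    compatible with [Ga], hence is the Levi-Civita connection of [Ga]. *)
Lemma connection_transition i x : U x ->
  connection Ga i x *m 'J phi x =
  mpartial i (jacobian phi) x + 'J phi x *m pullb i x.
Proof.
move=> Ux; rewrite -/(frame_derivative i x).
rewrite (@connection_unique _ _ _
  (fun i => frame_derivative i x *m invmx ('J phi x)) x); first last.
- move=> k; rewrite GaE// -!mulmxA mulKmx ?uJ// !mulmxA.
  exact: mpartial_Ga.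
- move=> a b c; rewrite !mxE; apply: eq_bigr => m _.
  by rewrite frame_derivative_sym.
- exact: uGa.
- exact: sGa.
by rewrite mulmxKV// uJ.
Qed.

Let conn_diff x k : U x -> mdiff (connection Ga k) x.
Proof. by apply: mCk_mdiff; exact: Ck_on_connection. Qed.

Let conn_diffb x k : V x -> mdiff (connection Gb k) x.
Proof. by apply: mCk_mdiff; exact: Ck_on_connection. Qed.

Lemma curvature_transition i j x : U x ->
  curvature (connection Ga) i j x *m 'J phi x =
  'J phi x *m \sum_p \sum_q ('J phi x i p * 'J phi x j q) *:
    curvature (connection Gb) p q (phi x).
Proof.
move=> Ux; have Vx := phiV Ux.
rewrite -curvature_pullback; first last.
- by move=> p; exact: JC.
- by move=> p; exact: conn_diffb.
- exact: dJ.
- exact: dphi.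
apply: curvature_gauge.
- by move=> k; apply: filterS (nearU Ux) => y; exact: connection_transition.
- by move=> k; exact: conn_diff.
- move=> k; apply: mdiff_sum => p; apply: mdiffZ; first exact: dJ.
  by apply: mdiff_comp; [exact: dphi|exact: conn_diffb].
- exact: dJ.
- by move=> k; apply: mCk_mdiff Ux; exact: mCk_mpartial.
- exact: mpartialC Ux.
Qed.

(** The curvature acquires two factors [J] as a 2-form and a conjugation by [J] as an endomorphism.
    The trace pairs one factor [J] with the inverse from the conjugation, leaving the two factors of
    a covariant 2-tensor. *)
Lemma ricci_transition x : U x ->
  ricci_mx (connection Ga) x =
  'J phi x *m ricci_mx (connection Gb) (phi x) *m ('J phi x)^T.
Proof.
move=> Ux; set J := 'J phi x; set K := invmx J.
have JK : J *m K = 1%:M by rewrite mulmxV// uJ.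
have KJ : K *m J = 1%:M by rewrite mulVmx// uJ.
have curvE i j : curvature (connection Ga) i j x =
    \sum_p \sum_q (J i p * J j q) *: (J *m curvature (connection Gb) p q (phi x) *m K).
  rewrite -[LHS]mulmx1 -JK mulmxA curvature_transition//.
  rewrite mulmx_sumr mulmx_suml; apply: eq_bigr => p _.
  rewrite mulmx_sumr mulmx_suml; apply: eq_bigr => q _.
  by rewrite -scalemxAr -scalemxAl.
pose M p q := J *m curvature (connection Gb) p q (phi x).
have curvkE i j k : curvature (connection Ga) i j x k i =
    \sum_q \sum_p J j q * ((M p q *m K) k i * J i p).
  rewrite curvE exchange_big /= summxE; apply: eq_bigr => q _.
  rewrite summxE; apply: eq_bigr => p _.
  by rewrite [LHS]mxE -/(M p q) mulrAC mulrC [J i p * _]mulrC.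
apply/matrixP => j k; rewrite mxE.
transitivity (\sum_q \sum_r J j q * (ricci_mx (connection Gb) (phi x) q r * J k r)).
  under eq_bigr do rewrite curvkE.
  rewrite exchange_big /=; apply: eq_bigr => q _.
  rewrite exchange_big /= -mulr_sumr.
  transitivity (J j q * \sum_p M p q k p).
    rewrite mulr_sumr; apply: eq_bigr => p _; rewrite -mulr_sumr; congr (_ * _).
    (* With [K *m J] inserted, the sum over the traced index becomes a matrix product. *)
    have -> : M p q k p = (M p q *m K *m J) k p by rewrite -mulmxA KJ mulmx1.
    by rewrite [RHS]mxE.
  congr (_ * _); under eq_bigr do rewrite mxE.
  rewrite exchange_big /=; apply: eq_bigr => r _.
  by rewrite -mulr_sumr mulrC [ricci_mx _ _ _ _]mxE.
rewrite exchange_big mxE /=; apply: eq_bigr => r _.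
rewrite [(J *m _) _ _]mxE [J^T _ _]mxE mulr_suml; apply: eq_bigr => q _.
by rewrite mulrA.
Qed.

Variables (fa fb : 'rV[R]_n -> R^o).
Hypotheses (cfb : Ck_on 2 V fb) (faE : forall x, U x -> fa x = fb (phi x)).

Lemma gradient_transition x : U x ->
  gradient fa x = 'J phi x *m gradient fb (phi x).
Proof.
move=> Ux; apply/matrixP => i j; rewrite ord1 !mxE.
rewrite -(eq_partial i (f := fun y => fb (phi y))); last first.
  by apply: filterS (nearU Ux) => y /faE.
rewrite (partial_comp (dphi Ux)); last by case: cfb => + _; apply; exact: phiV.
by apply: eq_bigr => k _; rewrite [gradient _ _ _ _]mxE.
Qed.

(** Differentiating the transformed gradient produces a derivative of [J], which the inhomogeneous
    term of [connection_transition] cancels. *)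
Lemma hessian_transition x : U x ->
  hessian_mx (connection Ga) fa x =
  'J phi x *m hessian_mx (connection Gb) fb (phi x) *m ('J phi x)^T.
Proof.
move=> Ux; have Vx := phiV Ux; set J := 'J phi x.
have dgb : mdiff (gradient fb) (phi x).
  move=> j k; under eq_fun do rewrite mxE.
  by case: cfb => _ /(_ (delta_mx 0 j))[+ _]; apply.
pose Hb p := mpartial p (gradient fb) (phi x)
  - connection Gb p (phi x) *m gradient fb (phi x).
have HaE i : mpartial i (gradient fa) x - connection Ga i x *m gradient fa x =
    \sum_p J i p *: (J *m Hb p).
  rewrite (eq_mpartial i (B := fun y => 'J phi y *m gradient fb (phi y))); last first.
    by apply: filterS (nearU Ux) => y; exact: gradient_transition.
  rewrite (mpartialM i (dJ Ux) (mdiff_comp (dphi Ux) dgb)).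
  rewrite (mpartial_comp (dphi Ux) i dgb) gradient_transition// mulmxA.
  rewrite connection_transition// mulmxDl opprD addrACA subrr add0r -mulmxA -mulmxBr.
  rewrite mulmx_suml -sumrB mulmx_sumr; apply: eq_bigr => p _.
  by rewrite -scalemxAl -scalerBr -scalemxAr.
apply/matrixP => i j; rewrite mxE HaE summxE mxE.
transitivity (\sum_p \sum_q J i p * (J j q * Hb p q 0)).
  by apply: eq_bigr => p _; rewrite [LHS]mxE [(J *m _) _ _]mxE mulr_sumr.
rewrite exchange_big /=; apply: eq_bigr => q _.
rewrite [(J *m _) _ _]mxE mulr_suml; apply: eq_bigr => p _.
by rewrite [J^T _ _]mxE [hessian_mx _ _ _ _ _]mxE -mulrA [X in _ * X]mulrC.
Qed.

End TensorTransition.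

(** * Quadratic forms on the timelike cone *)

Section Cone.
Context {R : realType} {n : nat}.
Implicit Types (A G F : 'M[R]_n) (u v w : 'rV[R]_n).

Definition bform A v w : R := (v *m A *m w^T) 0 0.

Lemma bformE A v w : bform A v w = \sum_i \sum_j A i j * v 0 i * w 0 j.
Proof.
rewrite /bform mxE exchange_big /=; apply: eq_bigr => j _.
rewrite !mxE mulr_suml; apply: eq_bigr => i _.
by rewrite [v 0 i * _]mulrC.
Qed.

Lemma bformDl A u v w : bform A (u + v) w = bform A u w + bform A v w.
Proof. by rewrite /bform !mulmxDl mxE. Qed.

Lemma bformDr A u v w : bform A u (v + w) = bform A u v + bform A u w.
Proof. by rewrite /bform linearD mulmxDr mxE. Qed.

Lemma bformZl A c u v : bform A (c *: u) v = c * bform A u v.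
Proof. by rewrite /bform -!scalemxAl mxE. Qed.

Lemma bformZr A c u v : bform A u (c *: v) = c * bform A u v.
Proof. by rewrite /bform linearZ -scalemxAr mxE. Qed.

Lemma bformC A v w : A^T = A -> bform A v w = bform A w v.
Proof.
move=> As; rewrite /bform -[in LHS](trmxK (v *m A *m w^T)) mxE.
by rewrite !trmx_mul trmxK As mulmxA.
Qed.

Lemma bform_shift A u v s : bform A (u + s *: v) (u + s *: v) =
  bform A u u + s * (bform A u v + bform A v u) + s ^+ 2 * bform A v v.
Proof. by rewrite !(bformDl, bformDr, bformZl, bformZr); ring. Qed.

Lemma bform_congr (P : 'M[R]_n) A v w :
  bform (P *m A *m P^T) v w = bform A (v *m P) (w *m P).
Proof. by rewrite /bform trmx_mul !mulmxA. Qed.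

Definition minkowski_mx (i0 : 'I_n) : 'M[R]_n :=
  diag_mx (\row_j (if j == i0 then -1 else 1)).

Let sq v := \sum_i v 0 i ^+ 2.

Let sq_ge0 v : 0 <= sq v. Proof. by apply: sumr_ge0 => i _; exact: sqr_ge0. Qed.

Let sq_coord v i : v 0 i ^+ 2 <= sq v.
Proof. by rewrite /sq (bigD1 i)//= lerDl sumr_ge0// => j _; exact: sqr_ge0. Qed.

Let sum_coord v i : \sum_j `|v 0 i| * `|v 0 j| <= n%:R * sq v.
Proof.
rewrite mulr_natl -[X in _ *+ X]card_ord -sumr_const; apply: ler_sum => j _.
have h1 := sq_coord v i; have h2 := sq_coord v j.
rewrite -[v 0 i ^+ 2]real_normK ?num_real// in h1.
rewrite -[v 0 j ^+ 2]real_normK ?num_real// in h2.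
have := sqr_ge0 (`|v 0 i| - `|v 0 j|); nra.
Qed.

Let sum_coord2 v : \sum_i \sum_j `|v 0 i| * `|v 0 j| <= n%:R * sq v.
Proof.
have E : \sum_i \sum_(j < n) (v 0 i ^+ 2 + v 0 j ^+ 2) / 2 = n%:R * sq v.
  under eq_bigr do rewrite -mulr_suml big_split sumr_const card_ord /=.
  rewrite -mulr_suml big_split sumr_const card_ord /= -/(sq v).
  by rewrite sumrMnl -/(sq v) -mulr_natl; field.
rewrite -E; apply: ler_sum => i _; apply: ler_sum => j _.
rewrite -[v 0 i ^+ 2]real_normK ?num_real//.
rewrite -[v 0 j ^+ 2]real_normK ?num_real//.
have := sqr_ge0 (`|v 0 i| - `|v 0 j|); lra.
Qed.

Let bform_minkowski i0 v :
  bform (minkowski_mx i0) v v + 2 * (v 0 i0) ^+ 2 = sq v.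
Proof.
rewrite bformE.
have E i : \sum_j minkowski_mx i0 i j * v 0 i * v 0 j =
    (if i == i0 then - 1 else 1) * v 0 i ^+ 2.
  rewrite (bigD1 i)//= big1 => [|j ji]; last first.
    by rewrite !mxE [i == j]eq_sym (negbTE ji) mulr0n !mul0r.
  by rewrite !mxE eqxx addr0 mulr1n -mulrA.
under eq_bigr do rewrite E.
rewrite /sq (bigD1 i0)//= [in RHS](bigD1 i0)//= eqxx.
rewrite (eq_bigr (fun i => v 0 i ^+ 2)) => [|i /negbTE ->]; last by rewrite mul1r.
by ring.
Qed.

(** * Bounds for a form close to Minkowski's *)

Section Bound.
Variables (i0 : 'I_n) (G F : 'M[R]_n) (K : R).
(** With this tolerance, summing the entrywise errors against |v_i| |v_j| costs at most a tenth of
    [sq v], by [sum_coord2]. *)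
Let eps : R := (10 * n%:R)^-1.
Hypothesis Gs : G^T = G.
Hypothesis Gnear : forall i j, `|G i j - minkowski_mx i0 i j| <= eps.
Hypothesis FK : forall i j, `|F i j| <= K.
Hypothesis Fnull : forall w, bform G w w = 0 -> 0 <= bform F w w.

Let n0 : (0 : R) < n%:R.
Proof. by rewrite ltr0n (leq_ltn_trans _ (ltn_ord i0)). Qed.

Let epsn : eps * n%:R = 1 / 10.
Proof. by rewrite /eps; field; rewrite gt_eqF. Qed.

Let eps_ge0 : 0 <= eps. Proof. by rewrite invr_ge0 mulr_ge0// ltW. Qed.

Let e : 'rV[R]_n := delta_mx 0 i0.

Let bform_e A v : bform A v e = \sum_i A i i0 * v 0 i.
Proof.
rewrite /bform /e trmx_delta -colE !mxE; apply: eq_bigr => i _.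
by rewrite mulrC.
Qed.

Let bform_el A v : bform A e v = \sum_i A i0 i * v 0 i.
Proof.
rewrite /bform /e -rowE !mxE; apply: eq_bigr => i _.
by rewrite !mxE.
Qed.

Let bform_ee A : bform A e e = A i0 i0.
Proof. by rewrite /bform /e trmx_delta -rowE -colE !mxE. Qed.

Let beta v := bform G v e.

(* g + 2 g(e, .)^2 is the Euclidean form if g is Minkowski's, hence it remains *)
(* positive definite, with a uniform constant, if g is close to Minkowski's.   *)
Let coercive v : sq v / 2 <= bform G v v + 2 * beta v ^+ 2.
Proof.
have h1 : `|bform G v v - bform (minkowski_mx i0) v v| <= eps * (n%:R * sq v).
  rewrite !bformE -sumrB; apply: le_trans (ler_norm_sum _ _ _) _.
  apply: (@le_trans _ _ (\sum_i \sum_j eps * (`|v 0 i| * `|v 0 j|))).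
    apply: ler_sum => i _; rewrite -sumrB.
    apply: le_trans (ler_norm_sum _ _ _) _; apply: ler_sum => j _.
    rewrite -!mulrBl !normrM -mulrA ler_wpM2r ?mulr_ge0//.
  under eq_bigr do rewrite -mulr_sumr.
  by rewrite -mulr_sumr ler_wpM2l.
have bm : bform (minkowski_mx i0) v e = - v 0 i0.
  rewrite bform_e (bigD1 i0)//= big1 => [|i ii]; last first.
    by rewrite !mxE (negbTE ii) mul0r.
  by rewrite !mxE !eqxx addr0 mulN1r.
(* The deviation of [beta v] from its value [- v 0 i0] for Minkowski's form. *)
pose d := beta v + v 0 i0.
have h2 : `|v 0 i0| * `|d| <= eps * (n%:R * sq v).
  have -> : d = \sum_i (G i i0 - minkowski_mx i0 i i0) * v 0 i.
    under eq_bigr do rewrite mulrBl.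
    by rewrite sumrB -!bform_e bm opprK.
  apply: (@le_trans _ _ (\sum_i eps * (`|v 0 i0| * `|v 0 i|))).
    apply: (@le_trans _ _ (`|v 0 i0| *
        \sum_i `|(G i i0 - minkowski_mx i0 i i0) * v 0 i|)).
      by rewrite ler_wpM2l// ler_norm_sum.
    rewrite mulr_sumr; apply: ler_sum => i _.
    by rewrite normrM mulrCA ler_wpM2r ?mulr_ge0.
  by rewrite -mulr_sumr ler_wpM2l.
have bE : beta v = d - v 0 i0 by rewrite addrK.
have h3 := bform_minkowski i0 v.
rewrite mulrA epsn in h1 h2.
have h4 : v 0 i0 * d <= 1 / 10 * sq v.
  by apply: le_trans h2; rewrite -normrM ler_norm.
move: h1; rewrite ler_norml => /andP[h1 _].
rewrite bE; have := sqr_ge0 d; have := sq_ge0 v; nra.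
Qed.

Let alpha := - G i0 i0.

Let alpha_ge : 1 / 2 <= alpha.
Proof.
have := Gnear i0 i0; rewrite ler_norml => /andP[_].
have : eps <= 1 / 10.
  by rewrite -epsn ler_peMr// ler1n -(ltr_nat R).
rewrite !mxE !eqxx mulr1n /alpha; lra.
Qed.

(** Reverse Cauchy-Schwarz inequality: [u] is the multiple by [alpha] of the component of [v]
    orthogonal to [e], and [coercive] makes [G] nonnegative on the orthogonal of [e]. *)
Let discr_ge0 v : 0 <= beta v ^+ 2 - alpha * - bform G v v.
Proof.
pose u := beta v *: e + alpha *: v.
have ue : beta u = 0.
  rewrite /beta /u bformDl !bformZl bform_ee /alpha -/(beta v); ring.
have := coercive u; rewrite ue expr0n mulr0 addr0.
have -> : bform G u u = alpha * (beta v ^+ 2 - alpha * - bform G v v).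
  rewrite /u bform_shift !(bformZl, bformZr) bform_ee [bform G e v]bformC//.
  rewrite -/(beta v) /alpha; ring.
move=> h; have : 0 <= alpha * (beta v ^+ 2 - alpha * - bform G v v).
  by apply: le_trans h; rewrite divr_ge0.
by rewrite pmulr_rge0//; have := alpha_ge; lra.
Qed.

(** In the expansion of [F] at the null vector v - s e, each of the two mixed terms costs at most 2
    n K |g(v, v)| and the term in s^2 at most 2 K |g(v, v)|; hence the constant. *)
Lemma cone_bound v : bform G v v < 0 ->
  (4 * n%:R + 2) * K * bform G v v <= bform F v v.
Proof.
move=> vt; set c := bform G v v; pose b := beta v.
have cE : bform G v v = c by [].
have c0 : c < 0 by [].
have D0 := discr_ge0 v; rewrite cE -/b in D0.
have co := coercive v; rewrite cE -/b in co.
have a2 := alpha_ge.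
have sq0 := sq_ge0 v.
(* A timelike vector is not orthogonal to [e], by [coercive]. *)
have b0 : b != 0.
  by apply/eqP => b0; move: co; rewrite b0 expr0n /= mulr0 addr0; lra.
have b2 : 0 < b ^+ 2 by rewrite exprn_even_gt0.
pose d := Num.sg b * Num.sqrt (b ^+ 2 - alpha * - c).
have d2 : d ^+ 2 = b ^+ 2 - alpha * - c.
  by rewrite exprMn sqr_sg b0 mul1r sqr_sqrtr.
have bd : 0 <= b * d.
  by rewrite mulrA [b * _]mulrC -normrEsg mulr_ge0// sqrtr_ge0.
(* Since [b] and [d] have the same sign there is no cancellation in [b + d], so |s| is at most |c| /
   |b|. *)
have bd2 : b ^+ 2 <= (b + d) ^+ 2 
  by rewrite sqrrD -addrA lerDl addr_ge0 ?sqr_ge0 ?mulrn_wge0.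
have bd0 : b + d != 0.
  by apply: contraTneq bd2 => ->; rewrite expr0n -ltNge.
(* the smaller root of alpha s^2 + 2 b s - c, so that v - s e is null; d is *)
(* a square root of the discriminant having the sign of b *)
pose s := c / (b + d).
have sb : s * (b + d) = c by rewrite mulfVK.
clearbody s.
have root : alpha * s ^+ 2 + 2 * b * s - c = 0.
  apply: (mulIf (expf_neq0 2 bd0)); rewrite mul0r.
  have -> : (alpha * s ^+ 2 + 2 * b * s - c) * (b + d) ^+ 2 =
      alpha * (s * (b + d)) ^+ 2 + 2 * b * (s * (b + d)) * (b + d)
      - c * (b + d) ^+ 2 by ring.
  rewrite sb.
  have -> : alpha * c ^+ 2 + 2 * b * c * (b + d) - c * (b + d) ^+ 2 =
     c * (alpha * c + b ^+ 2 - d ^+ 2) by ring.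
  by rewrite d2; ring.
have null : bform G (v + - s *: e) (v + - s *: e) = 0.
  rewrite bform_shift [bform G e v]bformC// bform_ee cE.
  by rewrite -/(beta v) -/b -[G i0 i0]opprK -/alpha -[RHS]oppr0 -root; ring.
have := Fnull null; rewrite bform_shift bform_ee.
have K0 : 0 <= K := le_trans (normr_ge0 _) (FK i0 i0).
have s2b : s ^+ 2 * b ^+ 2 <= c ^+ 2.
  by rewrite -sb exprMn ler_wpM2l ?sqr_ge0.
(* The discriminant bound and alpha >= 1/2 give |c| <= 2 b^2, hence c^2 <= 2 |c| b^2. *)
have s2 : s ^+ 2 <= 2 * - c.
  rewrite -(ler_pM2r b2) (le_trans s2b)//.
  have : alpha * - c <= b ^+ 2 by lra.
  nra.
(* By [coercive] and c < 0, [sq v] is at most 4 b^2. *)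
have sv i : `|s| * `|v 0 i| <= 2 * - c.
  rewrite -normrM -[2 * _]ger0_norm; last by lra.
  rewrite -ler_sqr ?nnegrE ?normr_ge0// !real_normK ?num_real// exprMn.
  apply: (@le_trans _ _ (s ^+ 2 * (4 * b ^+ 2))).
    by apply: ler_wpM2l; [exact: sqr_ge0|have := sq_coord v i; lra].
  by rewrite mulrCA exprMn sqrrN -natrX ler_wpM2l.
have Fsum (f : 'I_n -> R) : (forall i, `|f i| <= K) ->
    - (2 * n%:R * K * - c) <= s * (\sum_i f i * v 0 i).
  move=> fK; rewrite lerNl -mulrN -sumrN.
  apply: (@le_trans _ _ (\sum_(i < n) K * (2 * - c))).
    rewrite mulr_sumr; apply: ler_sum => i _.
    apply: le_trans (ler_norm _) _; rewrite mulrN normrN mulrCA 2!normrM.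
    by rewrite ler_pM// ?mulr_ge0// -normrM ?normrM.
  by rewrite sumr_const card_ord -mulr_natl; rewrite le_eqVlt; apply/orP; left;
    apply/eqP; ring.
have h1 := Fsum (fun i => F i i0) (fun i => FK i i0).
have h2 := Fsum (fun i => F i0 i) (fun i => FK i0 i).
rewrite -bform_e in h1; rewrite -bform_el in h2.
have h3 : s ^+ 2 * F i0 i0 <= 2 * - c * K.
  apply: le_trans (ler_wpM2l (sqr_ge0 s) (le_trans (ler_norm _) (FK i0 i0))) _.
  exact: ler_wpM2r.
move: h1 h2 h3; rewrite sqrrN mulNr mulrDr.
set x := bform F v v; set y := s * bform F v e; set z := s * bform F e v.
by lra.
Qed.

End Bound.
End Cone.

(** * Null and timelike conditions for continuous families of forms *)

Section LocalCone.
Context {R : realType} {n : nat}.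
Implicit Types (U : set 'rV[R]_n) (G F : 'rV[R]_n -> 'M[R]_n).

Lemma mCk_congr k U (P : 'M[R]_n) G : open U -> mCk k U G ->
  mCk k U (fun x => P *m G x *m P^T).
Proof.
move=> oU cG i j.
have h : Ck_on k U (fun x => \sum_m (\sum_l P i l * G x l m) * P^T m j : R^o).
  apply: Ck_on_sum => // m; apply: Ck_onM => //; last exact: Ck_on_cst.
  apply: Ck_on_sum => // l; apply: Ck_onM => //; exact: Ck_on_cst.
apply: eq_Ck_on h => // x _; rewrite mxE; apply: eq_bigr => m _.
by rewrite [(P *m _) _ _]mxE.
Qed.

(** In the basis given by [P] the form [G x0] is Minkowski's, so by continuity [cone_bound] applies
    near [x0] with one bound on the entries of [F]. The null condition is required only at the point
    [x] itself, while [C] is uniform. *)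
Lemma local_cone_bound U G F x0 : open U -> U x0 ->
  mCk 0 U G -> mCk 0 U F -> lorentzian (G x0) ->
  (forall x, U x -> (G x)^T = G x) ->
  exists C : R, \forall x \near x0,
    (forall w, bform (G x) w w = 0 -> 0 <= bform (F x) w w) ->
    forall v, bform (G x) v v < 0 -> C * bform (G x) v v <= bform (F x) v v.
Proof.
move=> oU Ux0 cG cF [_ [i0 [P [uP GP]]]] Gs.
pose A x := P *m G x *m P^T; pose B x := P *m F x *m P^T.
have cA i j : {for x0, continuous (fun x => A x i j : R^o)}.
  exact: Ck_on_continuous (mCk_congr P oU cG i j) Ux0.
have cB i j : {for x0, continuous (fun x => B x i j : R^o)}.
  exact: Ck_on_continuous (mCk_congr P oU cF i j) Ux0.
(* Exceeds every entry of [B x0] by at least 1, a margin that absorbs its variation near [x0]. *)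
pose K := \sum_i \sum_j (`|B x0 i j| + 1).
have eps0 : 0 < (10 * n%:R : R)^-1.
  by rewrite invr_gt0 mulr_gt0// ltr0n (leq_ltn_trans _ (ltn_ord i0)).
have near_all (Q : 'I_n -> 'I_n -> set 'rV[R]_n) :
    (forall i j, nbhs x0 (Q i j)) -> \forall x \near x0, forall i j, Q i j x.
  move=> Qx.
  apply: (@filter_forall _ _ (fun i x => forall j, Q i j x) (nbhs x0) _ _) => i.
  by apply: (@filter_forall _ _ (Q i) (nbhs x0) _ _) => j; exact: Qx.
have nA : \forall x \near x0, forall i j,
    `|A x i j - minkowski_mx i0 i j| <= (10 * n%:R)^-1.
  apply: (near_all (fun i j x => `|A x i j - _ i j| <= _)) => i j.
  move/cvgrPdist_le : (cA i j) => /(_ _ eps0); apply: filterS => x.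
  by rewrite distrC /A GP.
have nB : \forall x \near x0, forall i j, `|B x i j| <= K.
  apply: (near_all (fun i j x => `|B x i j| <= K)) => i j.
  move/cvgrPdist_le : (cB i j) => /(_ _ ltr01); apply: filterS => x h.
  apply: (@le_trans _ _ (`|B x0 i j| + 1)).
    rewrite -[B x i j](subrK (B x0 i j)) addrC (le_trans (ler_normD _ _))//.
    by rewrite lerD2l distrC.
  rewrite /K (bigD1 i)//= (bigD1 j)//= -addrA lerDl addr_ge0//.
    by apply: sumr_ge0 => k _; rewrite addr_ge0.
  by apply: sumr_ge0 => k _; apply: sumr_ge0 => l _; rewrite addr_ge0.
exists ((4 * n%:R + 2) * K).
have nU : \forall x \near x0, U x by exact: open_nbhs_nbhs.
apply: filterS (filterI nU (filterI nA nB)) => x [Ux [hA hB]] null v.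
have E M : bform M v v = bform (P *m M *m P^T) (v *m invmx P) (v *m invmx P).
  by rewrite bform_congr mulmxKV.
rewrite (E (G x)) (E (F x)); apply: (cone_bound (i0 := i0)) => //.
- by rewrite !trmx_mul trmxK Gs// mulmxA.
- by move=> w; rewrite !bform_congr; exact: null.
Qed.

(** After a change of sign of [e] if necessary, v + t e is timelike for every t > 0; the inequality
    there becomes the claim as t tends to 0. *)
Lemma null_cone_bound (G F : 'M[R]_n) (C : R) (v e : 'rV[R]_n) :
  G^T = G -> bform G e e < 0 -> bform G v v = 0 ->
  (forall w, bform G w w < 0 -> C * bform G w w <= bform F w w) ->
  0 <= bform F v v.
Proof.
move=> Gs; wlog ve : e / bform G v e <= 0.
  move=> H ee vv tl; have [ve|ve] := leP (bform G v e) 0; first exact: (H e).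
  apply: (H (- 1 *: e)) => //; first by rewrite bformZr mulN1r oppr_le0 ltW.
  by rewrite bformZl bformZr !mulN1r opprK.
move=> ee vv tl; rewrite leNgt; apply/negP => F0.
pose b := bform F v e + bform F e v - C * (2 * bform G v e).
pose c := bform F e e - C * bform G e e.
have ineq t : 0 < t -> 0 <= bform F v v + t * b + t ^+ 2 * c.
  move=> t0.
  have E : bform G (v + t *: e) (v + t *: e) =
      t * (2 * bform G v e) + t ^+ 2 * bform G e e.
    by rewrite bform_shift vv [bform G e v]bformC//; ring.
  have gt0 : bform G (v + t *: e) (v + t *: e) < 0.
    rewrite E; have : t * bform G v e <= 0 by rewrite pmulr_rle0.
    have : t ^+ 2 * bform G e e < 0 by rewrite pmulr_rlt0// exprn_gt0.
    lra.
  have := tl _ gt0; rewrite E bform_shift -subr_ge0 /b /c.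
  by move=> /le_trans; apply; rewrite le_eqVlt; apply/orP; left; apply/eqP; ring.
(* At t = m / (2 M), which is at most 1, the perturbation t b + t^2 c is at most m / 2 and cannot
   compensate -m. *)
pose m := - bform F v v; pose M := `|b| + `|c| + m + 1.
have m0 : 0 < m by rewrite oppr_gt0.
have M0 : 0 < M by have := normr_ge0 b; have := normr_ge0 c; rewrite /M; lra.
have t0 : 0 < m / (2 * M) by rewrite divr_gt0// mulr_gt0.
have := ineq _ t0; set t := m / (2 * M) in t0 *.
have tM : t * M = m / 2 by rewrite /t; field; rewrite gt_eqF.
have t1 : t <= 1.
  rewrite ler_pdivrMr ?mulr_gt0// mul1r /M.
  have := normr_ge0 b; have := normr_ge0 c; lra.
have tb : t * b <= t * `|b| by rewrite ler_pM2l// ler_norm.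
have tc : t ^+ 2 * c <= t * `|c|.
  apply: (@le_trans _ _ (t ^+ 2 * `|c|)).
    by rewrite ler_wpM2l ?sqr_ge0// ler_norm.
  by rewrite expr2 -mulrA ler_pM2l// ler_piMl.
have : t * (`|b| + `|c|) <= t * M.
  by rewrite ler_pM2l// /M -addrA lerDl addr_ge0// ltW.
rewrite mulrDr tM /m => h1 h2; suff : (0 : R) < 0 by rewrite ltxx.
by lra.
Qed.
End LocalCone.

Lemma minkowski_mx_unit (R : realType) (n : nat) (i0 : 'I_n) :
  @minkowski_mx R n i0 \in unitmx.
Proof.
rewrite unitmxE unitfE det_diag; apply/prodf_neq0 => j _; rewrite mxE.
by case: ifP => _; rewrite ?oppr_eq0 oner_eq0.
Qed.

Lemma lorentzian_unitmx (R : realType) (n : nat) (G : 'M[R]_n) :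
  lorentzian G -> G \in unitmx.
Proof.
move=> [_ [i0 [P [_ GP]]]]; have := minkowski_mx_unit R i0.
by rewrite /minkowski_mx -GP !unitmx_mul => /andP[/andP[_ ->]].
Qed.

Lemma lorentzian_timelike (R : realType) (n : nat) (G : 'M[R]_n) :
  lorentzian G -> exists e, bform G e e < 0.
Proof.
move=> [_ [i0 [P [_ GP]]]]; exists (delta_mx 0 i0 *m P).
rewrite -bform_congr GP /bform trmx_delta -rowE -colE !mxE !eqxx mulr1n.
by rewrite oppr_lt0.
Qed.

(** * Tensors on a manifold *)

Lemma jacobian_comp (R : realType) (m n p : nat) (f : 'rV[R]_m -> 'rV[R]_n)
    (h : 'rV[R]_n -> 'rV[R]_p) (x : 'rV[R]_m) :
  differentiable f x -> differentiable h (f x) ->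
  'J (h \o f) x = 'J f x *m 'J h (f x).
Proof.
move=> df dh; apply/row_matrixP => i; rewrite !rowE mulmxA.
by rewrite /jacobian !mul_rV_lin1 diff_comp.
Qed.

Lemma eq_jacobian (R : realType) (m n : nat) (f h : 'rV[R]_m -> 'rV[R]_n) x :
  {near x, f =1 h} -> differentiable f x -> 'J f x = 'J h x.
Proof.
move=> fh df; have dh := near_eq_differentiable fh df.
apply/row_matrixP => i; rewrite [LHS]rowE [RHS]rowE.
have E1 := deriveEjacobian (delta_mx 0 i) df.
have E2 := deriveEjacobian (delta_mx 0 i) dh.
exact: etrans (esym E1) (etrans (near_eq_derive _ fh) E2).
Qed.

Lemma jacobian_id (R : realType) (n : nat) (x : 'rV[R]_n) : 'J id x = 1%:M.
Proof.
apply/row_matrixP => i; rewrite !rowE mulmx1.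
have did : differentiable (@id 'rV[R]_n) x by exact: ex_diff.
exact: etrans (esym (deriveEjacobian _ did)) (derive_id _ _).
Qed.

Section Charts.
Variables (R : realType) (n : nat) (M : manifold R n).
Implicit Types (a b c : chart R n M) (p : M).

Lemma transitionE a b p : chart_dom a p -> transition a b (a p) = b p.
Proof. by move=> ap; rewrite /transition /= chart_mapK. Qed.

Lemma chart_img_mem a p : chart_dom a p -> chart_img a (a p).
Proof. by move=> ap; exists p. Qed.

Definition overlap a b : set 'rV[R]_n := a @` (chart_dom a `&` chart_dom b).

Lemma overlap_sub a b : overlap a b `<=` chart_img a.
Proof. by move=> x [p [ap _] <-]; exists p. Qed.

Lemma overlap_open a b : open (overlap a b).
Proof.
rewrite openE => x [p [ap bp] <-].
have h1 : nbhs (a p) (chart_img a).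
  by apply: open_nbhs_nbhs; split; [exact: chart_img_open|exact: chart_img_mem].
have h2 : nbhs (a p) (chart_inv a @^-1` chart_dom b).
  apply: (chart_inv_continuous (chart_img_mem ap)).
  rewrite chart_mapK//; apply: open_nbhs_nbhs; split => //.
  exact: chart_dom_open.
apply: filterS (filterI h1 h2) => y [[q aq <-]].
by rewrite /= chart_mapK// => bq; exists q.
Qed.

Lemma transition_img a b x : overlap a b x -> chart_img b (transition a b x).
Proof. by move=> [p [ap bp] <-]; rewrite transitionE//; exists p. Qed.

Lemma transition_Ck a b k : atlas a -> atlas b ->
  Ck_on k (overlap a b) (transition a b).
Proof. by move=> aa ab; exact: atlas_smooth. Qed.

Lemma transition_diff a b p : chart_around p a -> chart_around p b ->
  differentiable (transition a b) (a p).
Proof.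
move=> [aa ap] [ab bp]; have [+ _] := transition_Ck 1 aa ab; apply.
by exists p.
Qed.

Lemma near_chart a (P : set M) p : chart_dom a p -> open P -> P p ->
  \forall x \near a p, chart_img a x /\ P (chart_inv a x).
Proof.
move=> ap oP Pp; apply: filterI.
  by apply: open_nbhs_nbhs; split; [exact: chart_img_open|exact: chart_img_mem].
apply: (chart_inv_continuous (chart_img_mem ap)).
by rewrite chart_mapK//; exact: open_nbhs_nbhs.
Qed.

(** The chain rule; the transition from [a] to [c] factors through [b] only near [a p], where the
    points stay in the domain of [b]. *)
Lemma jacobian_cocycle a b c p :
  chart_around p a -> chart_around p b -> chart_around p c ->
  'J (transition a c) (a p) = 'J (transition a b) (a p) *m 'J (transition b c) (b p).
Proof.
move=> pa pb pc; have [aa ap] := pa; have [ab bp] := pb.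
have dab := transition_diff pa pb.
have dbc : differentiable (transition b c) (transition a b (a p)).
  by rewrite transitionE//; exact: transition_diff.
have := jacobian_comp dab dbc; rewrite (transitionE b ap) => <-.
apply/esym/eq_jacobian; last exact: differentiable_comp.
apply: filterS (near_chart ap (chart_dom_open b) bp) => x [_ bx].
by rewrite /transition /= chart_mapK.
Qed.

Lemma jacobian_transition_id a p : chart_around p a ->
  'J (transition a a) (a p) = 1%:M.
Proof.
move=> pa; have [_ ap] := pa; rewrite -[RHS](jacobian_id (a p)).
apply: eq_jacobian; last exact: transition_diff.
apply: filterS (near_chart ap (chart_dom_open a) ap) => x [[q aq <-] _].
by rewrite transitionE.
Qed.

Lemma jacobian_transition_unit a b p : chart_around p a -> chart_around p b ->
  'J (transition a b) (a p) \in unitmx.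
Proof.
move=> pa pb; have E := jacobian_cocycle pa pb pa.
exact: (mulmx1_unit (etrans (esym E) (jacobian_transition_id pa))).1.
Qed.

Lemma tangent_transition p (v : tangent p) a b :
  chart_around p a -> chart_around p b ->
  v b = v a *m 'J (transition a b) (a p).
Proof. by move=> pa pb; rewrite (tcomp_transition v pa pb) /jacobian mul_rV_lin1. Qed.

(** The components in the other charts are obtained with the Jacobians, and the cocycle identity
    makes them compatible. This transfers the conditions on tangent vectors to all row vectors. *)
Lemma tangent_exists p a (u : 'rV[R]_n) : chart_around p a ->
  exists v : tangent p, v a = u.
Proof.
move=> pa.
pose t c := if `[< chart_around p c >] then u *m 'J (transition a c) (a p) else 0.
have t_tr b c : chart_around p b -> chart_around p c ->
    t c = 'd (transition b c) (b p) (t b).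
  move=> pb pc; rewrite /t; do 2!case: asboolP => // _.
  by rewrite (jacobian_cocycle pa pb pc) mulmxA [in LHS]/jacobian mul_rV_lin1.
have t_out c : ~ chart_around p c -> t c = 0.
  by move=> pc; rewrite /t; case: asboolP.
exists (Tangent t_tr t_out) => /=; rewrite /t; case: asboolP => // _.
have E := jacobian_transition_id pa.
exact: etrans (congr1 (mulmx u) E) (mulmx1 u).
Qed.

Definition covariant (T : components M) := forall p a b,
  chart_around p a -> chart_around p b ->
  T a (a p) = 'J (transition a b) (a p) *m T b (b p)
    *m ('J (transition a b) (a p))^T.

(** Frees the value from the choice made by [chart_at], so that one chart serves a whole
    neighbourhood. *)
Lemma tensor_evalE (T : components M) p (v w : tangent p) a :
  covariant T -> chart_around p a ->
  tensor_eval T v w = bform (T a (a p)) (v a) (w a).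
Proof.
move=> cT pa; have pc := chart_atP p; rewrite /tensor_eval -bformE.
rewrite (cT _ _ _ pc pa) bform_congr.
by rewrite -!tangent_transition.
Qed.

Definition continuous_components (T : components M) :=
  forall a, atlas a -> mCk 0 (chart_img a) (T a).

Variable (g : lorentz_metric M).

Lemma metric_covariant : covariant (metric_comp g).
Proof. by move=> p a b; exact: metric_transition. Qed.

Lemma metric_sym a x : atlas a -> chart_img a x ->
  (metric_comp g a x)^T = metric_comp g a x.
Proof. by move=> aa ax; have [] := metric_lorentzian g aa ax. Qed.

Lemma metric_unitmx a x : atlas a -> chart_img a x ->
  metric_comp g a x \in unitmx.
Proof. by move=> aa ax; apply: lorentzian_unitmx; exact: metric_lorentzian. Qed.

Lemma metric_mC2 a : atlas a -> mCk 2 (chart_img a) (metric_comp g a).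
Proof. by move=> aa i j; exact: metric_C2. Qed.

Lemma connection_C1 a i : atlas a ->
  mCk 1 (chart_img a) (connection (metric_comp g a) i).
Proof.
move=> aa; apply: Ck_on_connection; [exact: chart_img_open| |exact: metric_mC2].
by move=> x; exact: metric_unitmx.
Qed.

Lemma christoffelE a k i j x :
  christoffel g a k i j x = connection (metric_comp g a) i x j k.
Proof. by rewrite [RHS]mxE. Qed.

Lemma riemannE a l k i j x :
  riemann g a l k i j x = curvature (connection (metric_comp g a)) i j x k l.
Proof.
set C := connection (metric_comp g a).
have pE r s : partial r (christoffel g a l s k) x = mpartial r (C s) x k l.
  rewrite [RHS]mxE; congr (partial r _ x); apply/funext => y.
  exact: christoffelE.
have mE r s : \sum_m christoffel g a l s m x * christoffel g a m r k x =
    (C r x *m C s x) k l.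
  rewrite [RHS]mxE; apply: eq_bigr => m _.
  by rewrite mulrC; congr (_ * _); exact: christoffelE.
have addE (A B D E : 'M[R]_n) :
    (A - B + D - E) k l = A k l - B k l + D k l - E k l by rewrite !mxE.
rewrite /riemann sumrB addrA; apply: etrans _ (esym (addE _ _ _ _)).
by congr (_ - _ + _ - _); [exact: pE|exact: pE|exact: mE|exact: mE].
Qed.

Lemma ricci_compE a x :
  ricci_comp g a x = ricci_mx (connection (metric_comp g a)) x.
Proof.
apply/matrixP => j k; rewrite [LHS]mxE [RHS]mxE; apply: eq_bigr => i _.
exact: riemannE.
Qed.

Lemma hess_compE (V : M -> R) a x : hess_comp g V a x =
  hessian_mx (connection (metric_comp g a)) (V \o chart_inv a : _ -> R^o) x.
Proof.
apply/matrixP => i j; rewrite [LHS]mxE [RHS]mxE.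
have subE (A B : 'cV[R]_n) : (A - B) j 0 = A j 0 - B j 0 by rewrite !mxE.
rewrite subE; congr (_ - _).
  by rewrite [RHS]mxE; congr (partial i _ x); apply/funext => y; rewrite mxE.
rewrite [RHS]mxE; apply: eq_bigr => k _; rewrite [gradient _ _ _ _]mxE.
by congr (_ * _); exact: christoffelE.
Qed.

Lemma ricci_covariant : covariant (ricci_comp g).
Proof.
move=> p a b pa pb; have [aa ap] := pa; have [ab bp] := pb.
rewrite !ricci_compE.
have aU : overlap a b (a p) by exists p.
have E : ricci_mx (connection (metric_comp g a)) (a p) =
    'J (transition a b) (a p) *m
    ricci_mx (connection (metric_comp g b)) (transition a b (a p)) *m
    ('J (transition a b) (a p))^T.
  apply: (ricci_transition (U := overlap a b) (V := chart_img b)) => //.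
  - exact: overlap_open.
  - exact: chart_img_open.
  - exact: transition_Ck.
  - by move=> x; exact: transition_img.
  - by move=> x [q [aq bq] <-]; exact: jacobian_transition_unit.
  - by move=> i j; apply: Ck_on_sub (metric_C2 g aa i j); exact: overlap_sub.
  - exact: metric_mC2.
  - by move=> x /overlap_sub; exact: metric_unitmx.
  - by move=> x; exact: metric_unitmx.
  - by move=> x /overlap_sub; exact: metric_sym.
  - by move=> x; exact: metric_sym.
  - move=> x [q [aq bq] <-]; rewrite (transitionE b aq).
    by apply: metric_covariant.
by move: E; rewrite (transitionE b ap).
Qed.

Lemma ricci_continuous : continuous_components (ricci_comp g).
Proof.
move=> a aa; rewrite (_ : ricci_comp g a = ricci_mx (connection (metric_comp g a))).
  by apply: mCk_ricci_mx; [exact: chart_img_open|move=> l; exact: connection_C1].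
by apply/funext => x; exact: ricci_compE.
Qed.

Section Weight.
Variable V : M -> R.
Hypothesis cV : weight_C2 V.
Local Notation W a := (V \o chart_inv a : 'rV[R]_n -> R^o).

Let W_transition a b x : overlap a b x -> W a x = W b (transition a b x).
Proof.
by move=> [q [aq bq] <-]; rewrite /= (transitionE b aq) !chart_mapK.
Qed.

Lemma weight_gradient_transition p a b :
  chart_around p a -> chart_around p b ->
  gradient (W a) (a p) = 'J (transition a b) (a p) *m gradient (W b) (b p).
Proof.
move=> pa pb; have [aa ap] := pa; have [ab bp] := pb.
have aU : overlap a b (a p) by exists p.
have E : gradient (W a) (a p) =
    'J (transition a b) (a p) *m gradient (W b) (transition a b (a p)).
  apply: (gradient_transition (U := overlap a b) (V := chart_img b)) => //.
  - exact: overlap_open.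
  - exact: (transition_Ck 3).
  - by move=> x; exact: transition_img.
  - exact: cV.
  - by move=> x; exact: W_transition.
by move: E; rewrite (transitionE b ap).
Qed.

Lemma hess_covariant : covariant (hess_comp g V).
Proof.
move=> p a b pa pb; have [aa ap] := pa; have [ab bp] := pb.
rewrite !hess_compE.
have aU : overlap a b (a p) by exists p.
have E : hessian_mx (connection (metric_comp g a)) (W a) (a p) =
    'J (transition a b) (a p) *m
    hessian_mx (connection (metric_comp g b)) (W b) (transition a b (a p)) *m
    ('J (transition a b) (a p))^T.
  apply: (hessian_transition (U := overlap a b) (V := chart_img b)) => //.
  - exact: overlap_open.
  - exact: chart_img_open.
  - exact: transition_Ck.
  - by move=> x; exact: transition_img.
  - by move=> x [q [aq bq] <-]; exact: jacobian_transition_unit.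
  - exact: metric_mC2.
  - by move=> x /overlap_sub; exact: metric_unitmx.
  - by move=> x; exact: metric_unitmx.
  - by move=> x /overlap_sub; exact: metric_sym.
  - by move=> x; exact: metric_sym.
  - move=> x [q [aq bq] <-]; rewrite (transitionE b aq).
    by apply: metric_covariant.
  - exact: cV.
  - by move=> x; exact: W_transition.
by move: E; rewrite (transitionE b ap).
Qed.

Lemma hess_continuous : continuous_components (hess_comp g V).
Proof.
move=> a aa.
rewrite (_ : hess_comp g V a = hessian_mx (connection (metric_comp g a)) (W a)).
  apply: mCk_hessian_mx; [exact: chart_img_open| |exact: cV].
  by move=> l; apply: mCkW; exact: connection_C1.
by apply/funext => x; exact: hess_compE.
Qed.

(** Here [r] stands for 1/(N - n), and the column times its transpose gives the components of DV
    tensor DV. *)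
Definition bakry_emery_comp (r : R) : components M := fun a x =>
  ricci_comp g a x + hess_comp g V a x
  - r *: (gradient (W a) x *m (gradient (W a) x)^T).

Lemma bakry_emery_covariant r : covariant (bakry_emery_comp r).
Proof.
move=> p a b pa pb; rewrite /bakry_emery_comp (ricci_covariant pa pb).
rewrite (hess_covariant pa pb) (weight_gradient_transition pa pb).
rewrite !(mulmxBr, mulmxDr, mulmxBl, mulmxDl) trmx_mul.
by rewrite -scalemxAr -scalemxAl !mulmxA.
Qed.

Lemma bakry_emery_continuous r : continuous_components (bakry_emery_comp r).
Proof.
move=> a aa; have oa : open (chart_img a) by exact: chart_img_open.
have cW : mCk 0 (chart_img a) (gradient (W a)).
  by apply: mCkW; apply: mCk_gradient; exact: cV.
have cR := ricci_continuous aa; have cH := hess_continuous aa.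
exact: (mCkB oa (mCkD oa cR cH) (mCkZ r oa (mCkM oa cW (mCk_tr oa cW)))).
Qed.

Lemma bakry_emery_eval (N : R) p (v w : tangent p) : N != n%:R ->
  bakry_emery_ricci g N V v w =
  tensor_eval (bakry_emery_comp (N - n%:R)^-1) v w.
Proof.
move=> /negbTE Nn; rewrite /bakry_emery_ricci Nn /ricci /hess /tensor_eval.
rewrite -!bformE /bakry_emery_comp; set a := chart_at p.
have bD (A B C : 'M[R]_n) (r : R) u1 u2 : bform (A + B - r *: C) u1 u2 =
    bform A u1 u2 + bform B u1 u2 - r * bform C u1 u2.
  by rewrite /bform mulmxBr mulmxDr mulmxBl mulmxDl -scalemxAr -scalemxAl !mxE.
rewrite bD; congr (_ - _ * _).
have dE (u : tangent p) : dweight V u = (u a *m gradient (W a) (a p)) 0 0.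
  by rewrite mxE; apply: eq_bigr => i _; rewrite mulrC [gradient _ _ _ _]mxE.
rewrite !dE /bform mulmxA -mulmxA -trmx_mul [RHS]mxE big_ord1.
by rewrite [(_^T) _ _]mxE.
Qed.

End Weight.

End Charts.

(** * The equivalence for a continuous covariant 2-tensor *)

Section ConeCondition.
Variables (R : realType) (n : nat) (M : manifold R n) (g : lorentz_metric M).
Variable T : components M.
Hypotheses (covT : covariant T) (contT : continuous_components T).

Lemma metric_bform p (v w : tangent p) a : chart_around p a ->
  metric g v w = bform (metric_comp g a (a p)) (v a) (w a).
Proof. by move=> pa; apply: tensor_evalE pa; exact: metric_covariant. Qed.

Lemma null_of_timelike p (C : R) :
  (forall v : tangent p, metric g v v < 0 -> C * metric g v v <= tensor_eval T v v) ->
  forall v : tangent p, metric g v v = 0 -> 0 <= tensor_eval T v v.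
Proof.
move=> tl v; have pa := chart_atP p; set a := chart_at p in pa.
have [aa ap] := pa; have api := chart_img_mem ap.
have lor := metric_lorentzian g aa api.
rewrite (metric_bform v v pa) (tensor_evalE v v covT pa) => vv.
have [e ee] := lorentzian_timelike lor.
apply: (null_cone_bound _ ee vv) => [|u uu]; first by case: lor.
have [w wu] := tangent_exists u pa.
have := tl w; rewrite (metric_bform w w pa) (tensor_evalE w w covT pa) wu.
exact.
Qed.

(** All points near [p0] are treated in the single chart [chart_at p0], where [local_cone_bound]
    applies. *)
Lemma local_timelike_bound (p0 : M) :
  (forall (p : M) (v : tangent p), metric g v v = 0 -> 0 <= tensor_eval T v v) ->
  exists C : R, \forall p \near p0, forall v : tangent p,
    metric g v v < 0 -> C * metric g v v <= tensor_eval T v v.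
Proof.
move=> null; have pa := chart_atP p0; set a := chart_at p0 in pa.
have [aa ap] := pa; have api := chart_img_mem ap.
have oa : open (chart_img a) by exact: chart_img_open.
have [C nC] := local_cone_bound oa api
  (mCkW (mCkW (metric_mC2 g aa))) (contT aa) (metric_lorentzian g aa api)
  (fun x => @metric_sym _ _ _ g a x aa).
exists C.
have nC' := chart_map_continuous ap nC.
have na : nbhs p0 (chart_dom a).
  by apply: open_nbhs_nbhs; split => //; exact: chart_dom_open.
apply: filterS (filterI na nC') => p [adp] /= bound v.
have pa' : chart_around p a by [].
rewrite (metric_bform v v pa') (tensor_evalE v v covT pa').
apply: bound => u uu; have [w wu] := tangent_exists u pa'.
have := null p w; rewrite (metric_bform w w pa') (tensor_evalE w w covT pa') wu.
exact.
Qed.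

(** Compactness merges the local constants into one; conversely, the timelike condition is applied
    to one-point sets. *)
Lemma cone_condition :
  (forall (p : M) (v : tangent p), metric g v v = 0 -> 0 <= tensor_eval T v v) <->
  (forall Z : set M, compact Z -> exists C : R, forall p (v : tangent p),
     Z p -> metric g v v < 0 -> C * metric g v v <= tensor_eval T v v).
Proof.
split=> [null Z /compact_near_coveringP cZ|tl p].
  pose Q (C : R) p := forall v : tangent p,
    metric g v v < 0 -> C * metric g v v <= tensor_eval T v v.
  have QZ : \forall C \near +oo, Z `<=` Q C.
    apply: cZ => p0 Zp0; have [C nC] := local_timelike_bound p0 null.
    (* Since g(v, v) < 0, a bound with [C] persists for every larger constant. The covering is
       therefore taken along the filter at infinity. *)
    exists ([set p | Q C p], [set C' | C <= C']) => /=.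
      by split => //; apply: nbhs_pinfty_ge; exact: num_real.
    move=> [p C'] /= [QC CC'] v vt; apply: le_trans (QC v vt).
    by rewrite ler_wnM2r// ltW.
  have [C QC] := filter_ex QZ.
  by exists C => p v Zp; exact: QC.
have [C tlC] := tl [set p] (@compact_set1 _ p).
apply: null_of_timelike (C) _ => v vt.
exact: tlC.
Qed.

End ConeCondition.

Theorem mainTheorem3 (R : realType) (n : nat) (M : manifold R n)
    (g : lorentz_metric M) (F : forall p : M, tangent p -> tangent p -> R) :
  (F = @ricci R n M g \/
   exists (N : R) (V : M -> R),
     [/\ n%:R <= N, weight_C2 V,
         (N = n%:R -> exists c : R, forall p : M, V p = c) &
         F = @bakry_emery_ricci R n M g N V]) ->
  ((forall (p : M) (v : tangent p), metric g v v = 0 -> 0 <= F p v v)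
   <->
   (forall Z : set M, compact Z ->
      exists C : R, forall (p : M) (v : tangent p),
        Z p -> metric g v v < 0 -> C * metric g v v <= F p v v)).
Proof.
move=> HF.
(* Only the diagonal values of [F] matter, and these come from a covariant tensor with continuous
   components. *)
suff [T [covT contT FT]] : exists T : components M,
    [/\ covariant T, continuous_components T &
       forall (p : M) (v : tangent p), F p v v = tensor_eval T v v].
  have [tl null] := cone_condition g covT contT.
  split=> [nullF Z cZ|tlF p v vv].
    have [p v vv|C tlC] := tl _ Z cZ; first by rewrite -FT; exact: nullF.
    by exists C => p v Zp vt; rewrite FT; exact: tlC.
  rewrite FT; apply: null vv => Z cZ; have [C tlC] := tlF Z cZ.
  by exists C => q w Zq wt; rewrite -FT; exact: tlC.
case: HF => [->|[N [V [_ cV _ ->]]]].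
  by exists (ricci_comp g); split; [exact: ricci_covariant|exact: ricci_continuous|].
(* For N = n the Bakry-Emery-Ricci tensor is by definition the Ricci tensor. *)
have [Nn|Nn] := eqVneq N n%:R.
  exists (ricci_comp g); split; [exact: ricci_covariant|exact: ricci_continuous|].
  by move=> p v; rewrite /bakry_emery_ricci Nn eqxx.
exists (bakry_emery_comp g V (N - n%:R)^-1); split.
- exact: bakry_emery_covariant.
- exact: bakry_emery_continuous.
- by move=> p v; exact: bakry_emery_eval.
Qed.
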